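(* Let $(\mathcal{A},m)$ be a free multiarrangement in $V=\mathbb{K}^\ell$. Then, for every $H\in\mathcal{A}$, the restriction map $$i_H^*\colon\Omega^1(\mathcal{A},m')\to\Omega^1(\mathcal{A}^H,m^* ),\qquad m'=m-\delta_H,$$ is surjective.
   Context: Let $\mathbb{K}$ be a field, $V=\mathbb{K}^\ell$, $S=\mathbb{K}[x_1,\dots,x_\ell]$ its coordinate ring, $\mathrm{Der}\,S=\bigoplus_i S\,\partial_{x_i}$, $\Omega^1_V=\bigoplus_i S\,dx_i$, $\Omega^p_V=\bigwedge^p\Omega^1_V$. An arrangement $\mathcal{A}$ is a finite set of linear hyperplanes in $V$; for each $H\in\mathcal{A}$ fix a linear form $\alpha_H\in V^*$ with $\ker\alpha_H=H$. A multiarrangement $(\mathcal{A},m)$ is an arrangement with a map $m\colon\mathcal{A}\to\mathbb{Z}_{>0}$; a multiplicity $0$ is also allowed and means that the hyperplane is deleted. Put $Q(\mathcal{A},m)=\prod_{H\in\mathcal{A}}\alpha_H^{m(H)}$ and $$D(\mathcal{A},m)=\{\theta\in\mathrm{Der}\,S\mid\theta(\alpha_H)\in S\alpha_H^{m(H)}\ \forall H\in\mathcal{A}\},$$ $$\Omega^1(\mathcal{A},m)=\Big\{\omega\in\tfrac{1}{Q(\mathcal{A},m)}\Omega^1_V\ \Big|\ \omega\wedge d\alpha_H\in\tfrac{\alpha_H^{m(H)}}{Q(\mathcal{A},m)}\Omega^2_V\ \forall H\in\mathcal{A}\Big\}.$$ $(\mathcal{A},m)$ is free if $D(\mathcal{A},m)$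 (equivalently its $S$-dual $\Omega^1(\mathcal{A},m)$) is a free $S$-module. An element $\sum_i f_i\partial_{x_i}$ is homogeneous of degree $d$ if all $f_i$ are homogeneous of degree $d$. For $H\in\mathcal{A}$ with $m(H)\ge1$, let $\delta_H\colon\mathcal{A}\to\{0,1\}$ take value $1$ exactly at $H$, and $m'=m-\delta_H$. The restriction is $\mathcal{A}^H=\{L\cap H\mid L\in\mathcal{A}\setminus\{H\}\}$, an arrangement in $H$, whose coordinate ring is $\overline{S}=S/(\alpha_H)$. Euler multiplicity $m^*\colon\mathcal{A}^H\to\mathbb{Z}_{>0}$: for $X\in\mathcal{A}^H$ let $\mathcal{A}_X=\{K\in\mathcal{A}\mid K\supseteq X\}$ and $m_X=m|_{\mathcal{A}_X}$. The essentialization $(\mathcal{A}_X^e,m_X)$ in the $2$-dimensional space $V/X$ is free, and its module of logarithmic derivations has a homogeneous basis $\theta_X,\varphi_X$ with $\alpha_H\nmid\theta_X$ and $\alpha_H\mid\varphi_X$ (divisibility in the module of derivations). Set $m^*(X)=\deg\theta_X$. The map $i_H^*$ (restriction of forms along the inclusion $i_H\colon H\to V$): choosing coordinates with $x_1=\alpha_H$, any $\omega\in\Omega^1(\mathcal{A},m')$ can be written $\omega=g\,dx_1+\omega_0$ where $\omega_0$ involves only $dx_2,\dots,dx_\ell$ and has coefficients without poles along $H$; then $i_H^*(\omega)$ is $\omega_0$ with its coefficients reduced modulo $x_1$. It is known that $i_H^*(\omega)\in\Omega^1(\mathcal{A}^H,m^* )$. *)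

(* Defs.v *)
From HB Require Import structures.
From mathcomp Require Import all_boot all_order all_algebra.
From mathcomp Require Import finmap mpoly.

Set Implicit Arguments.
Unset Strict Implicit.
Unset Printing Implicit Defensive.

Import GRing.Theory.
Local Open Scope fset_scope.
Local Open Scope ring_scope.

(* V = K^l is 'rV[K]_l, and its coordinate ring S is {mpoly K[l]}. *)

Section Polynomials.
Variables (K : fieldType) (l : nat).
Local Notation S := {mpoly K[l]}.
Local Notation F := {fraction S}.

(* The element of S given by a linear function a on V. *)
Definition lin_poly (a : 'rV[K]_l -> K) : S :=
  \sum_(i < l) a (delta_mx 0 i) *: 'X_i.

(* A row vector theta over S is the derivation \sum_i theta_i d/dx_i. *)
Definition der_app (theta : 'rV[S]_l) (f : S) : S :=
  \sum_(i < l) theta 0 i * f^`M(i).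

Definition der_homog (d : nat) (theta : 'rV[S]_l) : Prop :=
  forall i, theta 0 i \is d.-homog.

Definition der_dvd (f : S) (theta : 'rV[S]_l) : Prop :=
  exists theta' : 'rV[S]_l, theta = f *: theta'.

(* A row vector omega over F is the rational 1-form \sum_i omega_i dx_i; a
   rational 2-form is given by the alternating matrix of its coefficients, the
   entry (i, j), i < j, being the coefficient of dx_i /\ dx_j. *)
Definition ext_d (f : S) : 'rV[F]_l := \row_i tofrac (f^`M(i)).

Definition wedge (omega eta : 'rV[F]_l) : 'M[F]_l :=
  \matrix_(i, j) (omega 0 i * eta 0 j - omega 0 j * eta 0 i).

(* Membership in c Omega^1_V (p = 1) or, for alternating W, in
   c Omega^2_V (p = l). *)
Definition in_multiple p (c : F) (W : 'M[F]_(p, l)) : Prop :=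
  exists W' : 'M[S]_(p, l), W = c *: map_mx (@tofrac S) W'.

End Polynomials.

(* D is meant to be (the membership predicate of) a submodule of M. *)
Definition is_basis (S : comNzRingType) (M : lmodType S) (D : M -> Prop)
    (n : nat) (b : n.-tuple M) : Prop :=
  (forall i, D (tnth b i)) /\
  (forall x, D x ->
     exists! c : {ffun 'I_n -> S}, x = \sum_(i < n) c i *: tnth b i).

Definition is_free (S : comNzRingType) (M : lmodType S) (D : M -> Prop) : Prop :=
  exists (n : nat) (b : n.-tuple M), is_basis D b.

Section Arrangements.
Variables (K : fieldType) (l : nat).
Local Notation S := {mpoly K[l]}.
Local Notation F := {fraction S}.
Local Notation space := {vspace 'rV[K]_l}.
Local Notation form := 'Hom('rV[K]_l, K^o).

(* Multiplicities and defining forms are functions on all subspaces of V, of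
   which only the values on the arrangement are ever used. *)
Implicit Types (A : {fset space}) (m : space -> nat) (alpha : space -> form).

Definition arrangement A : Prop := forall H, H \in A -> (\dim H).+1 = l.

Definition multiarrangement A m : Prop :=
  arrangement A /\ forall H, H \in A -> (0 < m H)%N.

Definition defining_forms A alpha : Prop :=
  forall H, H \in A -> lker (alpha H) = H.

Definition defpoly A m alpha : S :=
  \prod_(H <- A) lin_poly (alpha H) ^+ m H.

Definition log_der A m alpha (theta : 'rV[S]_l) : Prop :=
  forall H, H \in A ->
    exists g : S,
      der_app theta (lin_poly (alpha H)) = g * lin_poly (alpha H) ^+ m H.

Definition log_form A m alpha (omega : 'rV[F]_l) : Prop :=
  in_multiple (tofrac (defpoly A m alpha))^-1 omega /\
  forall H, H \in A ->
    in_multiple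
      (tofrac (lin_poly (alpha H) ^+ m H) / tofrac (defpoly A m alpha))
      (wedge omega (ext_d (lin_poly (alpha H)))).

Definition free_multiarrangement A m alpha : Prop :=
  is_free (log_der A m alpha).

Definition mult_pred m (H : space) : space -> nat :=
  fun L => (m L - (L == H))%N.

Definition localization A (X : space) : {fset space} :=
  [fset L in A | (X <= L)%VS].

End Arrangements.

(* The image of an arrangement whose hyperplanes contain X in V/X, the quotient
   being identified with K^2 by a surjection pi with kernel X. *)
Definition essentialization (K : fieldType) (l : nat)
    (A : {fset {vspace 'rV[K]_l}}) (pi : 'Hom('rV[K]_l, 'rV[K]_2)) :
    {fset {vspace 'rV[K]_2}} :=
  [fset (pi @: L)%VS | L in A].

(* m^*(X) = d, where X, of codimension 2 in V, is an element of A^H.  The degree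
   d depends on none of the existentially quantified choices. *)
Definition euler_multiplicity (K : fieldType) (l : nat)
    (A : {fset {vspace 'rV[K]_l}}) (m : {vspace 'rV[K]_l} -> nat)
    (H X : {vspace 'rV[K]_l}) (d : nat) : Prop :=
  exists (pi : 'Hom('rV[K]_l, 'rV[K]_2))
         (gamma : {vspace 'rV[K]_2} -> 'Hom('rV[K]_2, K^o))
         (theta phi : 'rV[{mpoly K[2]}]_2) (e : nat),
  let AX := essentialization (localization A X) pi in
  let mX := fun L => m (pi @^-1: L)%VS in
  let alphaH := lin_poly (gamma (pi @: H)%VS) in
  [/\ lker pi = X /\ limg pi = fullv,
      defining_forms AX gamma,
      is_basis (log_der AX mX gamma) [tuple theta; phi],
      der_homog d theta /\ der_homog e phi &
      ~ der_dvd alphaH theta /\ der_dvd alphaH phi].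

(* A hyperplane H of V is identified with K^k, k = l - 1, by an injective linear
   map iota : K^k -> V of image H, which plays the role of the inclusion i_H. *)
Section Restriction.
Variables (K : fieldType) (l k : nat).
Variable iota : 'Hom('rV[K]_k, 'rV[K]_l).
Local Notation S := {mpoly K[l]}.
Local Notation Sbar := {mpoly K[k]}.

(* A^H, as an arrangement in K^k. *)
Definition restriction (A : {fset {vspace 'rV[K]_l}}) (H : {vspace 'rV[K]_l}) :
    {fset {vspace 'rV[K]_k}} :=
  [fset (iota @^-1: (L :&: H))%VS | L in A `\ H].

(* The reduction S -> S/(alpha_H) = Sbar. *)
Definition poly_restr (f : S) : Sbar :=
  f \mPo [tuple lin_poly (fun y => iota y 0 j) | j < l].

(* r has no pole along H, and reduces to s.  A denominator is prime to alpha_H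
   exactly when its class in S/(alpha_H) is nonzero. *)
Definition frac_restr (r : {fraction S}) (s : {fraction Sbar}) : Prop :=
  exists f g : S,
    [/\ poly_restr g != 0, r = tofrac f / tofrac g &
        s = tofrac (poly_restr f) / tofrac (poly_restr g)].

(* The graph of i_H^*, in the coordinates x_1 = a, (x_2, .., x_l) = rho of V;
   when rho \o iota is the identity, the restrictions of x_2, .., x_l to H are
   the coordinates of K^k. *)
Definition form_restr (a : 'Hom('rV[K]_l, K^o)) (rho : 'Hom('rV[K]_l, 'rV[K]_k))
    (omega : 'rV[{fraction S}]_l) (eta : 'rV[{fraction Sbar}]_k) : Prop :=
  exists (g : {fraction S}) (r : 'I_k -> {fraction S}),
    omega = g *: ext_d (lin_poly a)
          + \sum_(i < k) r i *: ext_d (lin_poly (fun v => rho v 0 i))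
    /\ forall i, frac_restr (r i) (eta 0 i).

Lemma ext_d_lin_poly (a : 'rV[K]_l -> K) j :
  ext_d (lin_poly a) 0 j = tofrac (a (delta_mx 0 j))%:MP.
Proof.
rewrite mxE; congr tofrac; rewrite /lin_poly linear_sum /= (bigD1 j) //= big1.
  rewrite addr0 mderivZ mderivX mnm1E eqxx scale1r.
  have -> : (U_(j) - U_(j))%MM = 0%MM by apply/mnmP=> i; rewrite mnmBE subnn mnmE.
  by rewrite mpolyX0 alg_mpolyC.
by move=> i ne; rewrite mderivZ mderivX mnm1E (negPf ne) scale0r scaler0.
Qed.

Lemma contract_lin_poly (a : 'rV[K]_l -> K) (v : 'rV[K]_l) :
    (a v = \sum_j v 0 j * a (delta_mx 0 j)) ->
  \sum_j tofrac (v 0 j)%:MP * ext_d (lin_poly a) 0 j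
    = tofrac (a v)%:MP :> {fraction S}.
Proof.
move=> ->; rewrite !rmorph_sum /=.
by apply: eq_bigr => j _; rewrite ext_d_lin_poly !rmorphM.
Qed.

Lemma frac_restr_inj r s s' : frac_restr r s -> frac_restr r s' -> s = s'.
Proof.
move=> [f [g [g0 -> ->]]] [f' [g' [g'0 e ->]]].
have nz (n : nat) (h : {mpoly K[n]}) : h != 0 -> tofrac h != 0.
  by rewrite tofrac_eq0.
have nzr h : poly_restr h != 0 -> h != 0.
  by apply: contraNneq => ->; rewrite /poly_restr comp_mpoly0.
move/eqP: e; rewrite eqr_div ?nz ?nzr // -!rmorphM tofrac_eq => /eqP e.
by apply/eqP; rewrite eqr_div ?nz // -!rmorphM tofrac_eq e.
Qed.

(* form_restr is the graph of a (partial) map, which is independent of rho. *)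
Lemma form_restr_inj a rho rho' omega eta eta' :
    (lker a = limg iota) ->
    (rho \o iota)%VF = \1%VF -> (rho' \o iota)%VF = \1%VF ->
  form_restr a rho omega eta -> form_restr a rho' omega eta' -> eta = eta'.
Proof.
move=> ka.
have row_lin (W : lmodType K) (f : {linear 'rV[K]_l -> W}) v :
    f v = \sum_j v 0 j *: f (delta_mx 0 j).
  rewrite {1}[v]row_sum_delta linear_sum.
  by apply: eq_bigr => j _; rewrite linearZ.
have coord_lin (f : 'Hom('rV[K]_l, 'rV[K]_k)) i v :
    f v 0 i = \sum_j v 0 j * f (delta_mx 0 j) 0 i.
  by rewrite (row_lin _ f) summxE; apply: eq_bigr => j _; rewrite mxE.
pose e i := iota (delta_mx 0 i).
have coef (rho0 : 'Hom('rV[K]_l, 'rV[K]_k)) om g r :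
    (rho0 \o iota)%VF = \1%VF ->
    om = g *: ext_d (lin_poly a)
       + \sum_(i < k) r i *: ext_d (lin_poly (fun v => rho0 v 0 i)) ->
    forall i, r i = \sum_j tofrac (e i 0 j)%:MP * om 0 j.
  move=> rK -> i.
  under eq_bigr => j _ do rewrite [X in _ * X]mxE [X in _ * (X + _)]mxE summxE mulrDr mulr_sumr.
  rewrite big_split /= exchange_big /=.
  have -> : \sum_(j < l) tofrac (e i 0 j)%:MP
              * (g * ext_d (lin_poly a) 0 j) = 0.
    under eq_bigr => j _ do rewrite mulrCA.
    rewrite -mulr_sumr contract_lin_poly; last exact: (row_lin _ a).
    have -> : a (e i) = 0.
      by apply/eqP; rewrite -memv_ker ka memv_img ?memvf.
    by rewrite mpolyC0 rmorph0 mulr0.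
  rewrite add0r (bigD1 i) //= [X in _ + X]big1 ?addr0 => [|i' ne].
    under eq_bigr => j _ do rewrite [X in _ * X]mxE mulrCA.
    rewrite -mulr_sumr contract_lin_poly; last exact: (coord_lin rho0 i).
    have -> : rho0 (e i) = delta_mx 0 i by rewrite -comp_lfunE rK id_lfunE.
    by rewrite mxE !eqxx rmorph1 mulr1.
  under eq_bigr => j _ do rewrite [X in _ * X]mxE mulrCA.
  rewrite -mulr_sumr contract_lin_poly; last exact: (coord_lin rho0 i').
  have -> : rho0 (e i) = delta_mx 0 i by rewrite -comp_lfunE rK id_lfunE.
  by rewrite mxE (negPf ne) andbF mpolyC0 rmorph0 mulr0.
move=> rK r'K [g [r [er rh]]] [g' [r' [er' rh']]].
apply/rowP => i; apply: (frac_restr_inj (rh i)).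
by rewrite (coef rho omega g r) // -(coef rho' omega g' r').
Qed.

End Restriction.

(* Main.v *)
Require Import Defs.
From HB Require Import structures.
From mathcomp Require Import all_boot all_order all_algebra.
From mathcomp Require Import finmap mpoly.
From mathcomp Require Import ring zify.

(* Write a form of Omega^1(A, m) as p / Q with p a polynomial row.  Since D(A, m)
   is free, so is its dual F := Omega^1(A, m), and F contains Omega^1(A, m').
   The kernel of i_H^* on Omega^1(A, m') is alpha_H F, so the image M of i_H^*
   embeds in the free Sbar-module F / alpha_H F, and the quotient is torsion-free.
   Given eta in Omega^1(A^H, m^* ), put f_X := \prod_(Y != X) beta_Y^(m^* Y).  The
   form f_X eta only has a pole along X, and lifts to Omega^1(A_X, m'_X), which is
   contained in Omega^1(A, m'): the polar part dbeta_X / beta_X^(m^* X) is, up to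
   a scalar, the restriction of the element dual to theta_X in the rank 2
   arrangement A_X.  Hence every f_X eta lies in M.  As the f_X have no common
   factor, the coordinates of f_X eta in F / alpha_H F are divisible by f_X; so
   eta comes from an element of F, which is in Omega^1(A, m') because the
   quotient is torsion-free. *)

Import GRing.Theory.
Local Open Scope fset_scope.
Local Open Scope ring_scope.

Set Implicit Arguments.
Unset Strict Implicit.
Unset Printing Implicit Defensive.

(** * Divisibility by prime elements in an integral domain *)

Section Divisibility.
Variable R : idomainType.
Implicit Types a b c f g : R.

Definition divides a b := exists c, b = c * a.

Definition prime_elt a :=
  [/\ a != 0, ~ divides a 1 & forall f g, divides a (f * g) -> divides a f \/ divides a g].

Lemma divides_mull a b c : divides a b -> divides a (c * b).
Proof. by case=> d ->; exists (c * d); rewrite mulrA. Qed.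

Lemma divides_mulr a b c : divides a b -> divides a (b * c).
Proof. by rewrite mulrC; apply: divides_mull. Qed.

Lemma divides_refl a : divides a a.
Proof. by exists 1; rewrite mul1r. Qed.

Lemma divides0 a : divides a 0.
Proof. by exists 0; rewrite mul0r. Qed.

Lemma dividesD a b c : divides a b -> divides a c -> divides a (b + c).
Proof. by move=> [x ->] [y ->]; exists (x + y); rewrite mulrDl. Qed.

Lemma divides_sum a (I : Type) (r : seq I) (P : pred I) F :
  (forall i, P i -> divides a (F i)) -> divides a (\sum_(i <- r | P i) F i).
Proof.
by move=> aF; elim/big_ind: _ => //; [apply: divides0 | apply: dividesD].
Qed.

Lemma divides_trans a b c : divides a b -> divides b c -> divides a c.
Proof. by move=> ab [x ->]; apply: divides_mull. Qed.

Lemma divides_mul2l a b c : c != 0 -> divides (c * a) (c * b) -> divides a b.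
Proof.
by move=> c0 [x e]; exists x; apply: (mulfI c0); rewrite e mulrCA.
Qed.

(** Induction on [n]: the prime [a] divides [b * f] but not [b], hence divides [f], and cancelling
    one factor [a] leaves the statement for [n - 1]. *)
Lemma prime_pow_coprime a b n f :
  prime_elt a -> ~ divides a b -> divides (a ^+ n) (b * f) -> divides (a ^+ n) f.
Proof.
move=> [a0 _ ap] nab; elim: n f => [|n IHn] f; first by exists f; rewrite mulr1.
rewrite exprS => abf.
have /ap[//|[g fE]] : divides a (b * f).
  by apply: divides_trans abf; apply/divides_mulr/divides_refl.
have /IHn[h gE] : divides (a ^+ n) (b * g).
  by apply: (@divides_mul2l _ _ a); rewrite // mulrCA [a * g]mulrC -fE.
by exists h; rewrite fE gE -mulrA [_ * a]mulrC.
Qed.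

Lemma prime_ndvd_exp a b n : prime_elt a -> ~ divides a b -> ~ divides a (b ^+ n).
Proof.
move=> [_ a1 ap] nab; elim: n => [|n IHn]; first by rewrite expr0.
by rewrite exprS => /ap[].
Qed.

Lemma prime_ndvd_prod (I : eqType) (s : seq I) (p : I -> R) (n : I -> nat) a :
    prime_elt a -> {in s, forall i, ~ divides a (p i)} ->
  ~ divides a (\prod_(i <- s) p i ^+ n i).
Proof.
move=> pa; elim: s => [|i s IHs] nap.
  by rewrite big_nil; case: pa.
rewrite big_cons; case: (pa) => _ _ ap /ap[].
  by apply: prime_ndvd_exp => //; apply: nap; rewrite mem_head.
by apply: IHs => j js; apply: nap; rewrite inE js orbT.
Qed.

(** Split off one power, [f = g * p i ^+ n i]; by [prime_pow_coprime] the remaining prime powers all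
    divide [g], so the induction continues with [g]. *)
Lemma prod_prime_pow_dvd (I : eqType) (s : seq I) (p : I -> R) (n : I -> nat) f :
    uniq s -> {in s, forall i, prime_elt (p i)} ->
    {in s &, forall i j, i != j -> ~ divides (p i) (p j)} ->
    {in s, forall i, divides (p i ^+ n i) f} ->
  divides (\prod_(i <- s) p i ^+ n i) f.
Proof.
elim: s => [|i s IHs] /= in f *; first by rewrite big_nil; exists f; rewrite mulr1.
case/andP=> nis us pp pd pf.
have is_ : i \in i :: s by rewrite mem_head.
have ss j : j \in s -> j \in i :: s by rewrite inE => ->; rewrite orbT.
have [g gE] := pf i is_.
have [j js|j k js ks|j js|h hE] := IHs g us.
- exact/pp/ss.
- by apply: pd; apply: ss.
- have ij : j != i by apply: contraNneq nis => <-.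
  apply: (@prime_pow_coprime _ (p i ^+ n i)); first exact/pp/ss.
    by apply: prime_ndvd_exp; [exact/pp/ss | apply: pd => //; exact: ss].
  by rewrite mulrC -gE; apply/pf/ss.
by exists h; rewrite big_cons gE hE -mulrA [X in h * X]mulrC.
Qed.

End Divisibility.

(** * Pullback of polynomials along arbitrary linear maps, the inclusion of H being one case of
    [poly_restr] *)

Section Substitution.
Variable K : fieldType.

Lemma comp_mpolyA n k j (f : {mpoly K[n]}) (p : n.-tuple {mpoly K[k]})
    (q : k.-tuple {mpoly K[j]}) :
  (f \mPo p) \mPo q = f \mPo [tuple tnth p i \mPo q | i < n].
Proof.
rewrite (comp_mpolyEX f) (comp_mpolyEX f [tuple _ | _ < _]) raddf_sum /=.
apply: eq_bigr => e _; rewrite linearZ /= !comp_mpolyX rmorph_prod.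
congr (_ *: _); apply: eq_bigr => i _.
by rewrite rmorphXn tnth_mktuple.
Qed.

Lemma lin_polyE n (a : 'rV[K]_n -> K) (b : 'rV[K]_n -> K) :
  (forall i, a (delta_mx 0 i) = b (delta_mx 0 i)) -> lin_poly a = lin_poly b.
Proof. by move=> ab; apply: eq_bigr => i _; rewrite ab. Qed.

Lemma row_linE n (W : lmodType K) (f : {linear 'rV[K]_n -> W}) v :
  f v = \sum_j v 0 j *: f (delta_mx 0 j).
Proof.
rewrite {1}[v]row_sum_delta linear_sum.
by apply: eq_bigr => j _; rewrite linearZ.
Qed.

Lemma lin_polyZ n c (a : 'rV[K]_n -> K) :
  lin_poly (fun v => c * a v) = c *: lin_poly a.
Proof. by rewrite scaler_sumr; apply: eq_bigr => i _; rewrite scalerA. Qed.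

Section Pullback.
Variables k n : nat.
Implicit Types phi psi : 'Hom('rV[K]_k, 'rV[K]_n).

HB.instance Definition _ phi :=
  GRing.RMorphism.copy (poly_restr phi)
    (@comp_mpoly _ _ _ [tuple lin_poly (fun y => phi y 0 j) | j < n]).

Lemma poly_restrZ phi c f : poly_restr phi (c *: f) = c *: poly_restr phi f.
Proof. exact: comp_mpolyZ. Qed.

Lemma poly_restrX phi j : poly_restr phi 'X_j = lin_poly (fun y => phi y 0 j).
Proof. by rewrite /poly_restr comp_mpolyXU -tnth_nth tnth_mktuple. Qed.

Lemma poly_restr_lin phi (a : 'Hom('rV[K]_n, K^o)) :
  poly_restr phi (lin_poly a) = lin_poly (fun v => a (phi v)).
Proof.
rewrite rmorph_sum /=.
under eq_bigr => j _ do rewrite poly_restrZ poly_restrX scaler_sumr.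
rewrite exchange_big; apply: eq_bigr => i _ /=.
under eq_bigr => j _ do rewrite scalerA.
rewrite -scaler_suml (row_linE a); congr (_ *: _).
by apply: eq_bigr => j _; rewrite mulrC.
Qed.

(** Two ring morphisms that agree modulo an ideal on the variables agree modulo it everywhere; here
    the ideal is generated by [lin_poly a]. *)
Lemma poly_restr_congr phi psi (a : 'Hom('rV[K]_k, K^o)) u f :
    (forall v, phi v - psi v = a v *: u) ->
  divides (lin_poly a) (poly_restr phi f - poly_restr psi f).
Proof.
move=> e.
have eX j : divides (lin_poly a) (poly_restr phi 'X_j - poly_restr psi 'X_j).
  exists (u 0 j)%:MP; rewrite !poly_restrX mul_mpolyC -lin_polyZ /lin_poly.
  rewrite -sumrB; apply: eq_bigr => i _; rewrite -scalerBl mulrC.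
  by have /rowP/(_ j) := e (delta_mx 0 i); rewrite !mxE => ->.
have eM g h : divides (lin_poly a) (poly_restr phi g - poly_restr psi g) ->
    divides (lin_poly a) (poly_restr phi h - poly_restr psi h) ->
    divides (lin_poly a) (poly_restr phi (g * h) - poly_restr psi (g * h)).
  move=> ag ah; rewrite !rmorphM.
  have -> : poly_restr phi g * poly_restr phi h
      - poly_restr psi g * poly_restr psi h
    = (poly_restr phi g - poly_restr psi g) * poly_restr phi h
      + poly_restr psi g * (poly_restr phi h - poly_restr psi h).
    by rewrite mulrBl mulrBr addrA subrK.
  by apply: dividesD; [apply: divides_mulr | apply: divides_mull].
elim/mpolyind: f => [|c d f _ _ IHf]; first by rewrite !rmorph0 subrr; apply: divides0.
rewrite !rmorphD opprD addrACA; apply: dividesD => //.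
rewrite /= !poly_restrZ -scalerBr -mul_mpolyC; apply: divides_mull.
rewrite mpolyXE_id; elim/big_ind: _ => [|//|i _].
  by rewrite !rmorph1 subrr; apply: divides0.
elim: (d i) => [|j IHj]; last by rewrite exprS; apply: eM.
by rewrite !rmorph1 subrr; apply: divides0.
Qed.

End Pullback.

Lemma poly_restr_comp j k n (phi : 'Hom('rV[K]_j, 'rV[K]_k))
    (psi : 'Hom('rV[K]_k, 'rV[K]_n)) f :
  poly_restr phi (poly_restr psi f) = poly_restr (psi \o phi)%VF f.
Proof.
rewrite /poly_restr comp_mpolyA; congr (_ \mPo _); apply: eq_from_tnth => i.
rewrite !tnth_mktuple -[LHS]/(poly_restr phi (lin_poly (fun y => psi y 0 i))).
rewrite rmorph_sum /=.
under eq_bigr => h _ do rewrite poly_restrZ poly_restrX scaler_sumr.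
rewrite exchange_big; apply: eq_bigr => h _ /=.
under eq_bigr => g _ do rewrite scalerA.
rewrite -scaler_suml comp_lfunE (row_linE psi); congr (_ *: _).
by rewrite summxE; apply: eq_bigr => g _; rewrite mxE mulrC.
Qed.

Lemma poly_restr_id n f : poly_restr (\1%VF : 'End('rV[K]_n)) f = f.
Proof.
rewrite -[RHS]comp_mpoly_id /poly_restr; congr (_ \mPo _).
apply: eq_from_tnth => i; rewrite !tnth_mktuple /lin_poly (bigD1 i) //= big1.
  by rewrite id_lfunE mxE !eqxx scale1r addr0.
by move=> j ji; rewrite id_lfunE mxE eq_sym (negPf ji) andbF scale0r.
Qed.

(** The image of [phi] lies in the line spanned by [w], where a homogeneous polynomial is determined
    by its value at [w]. Applied to the coefficients of theta_X, this turns the degree of theta_X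
    into a pole order. *)
Lemma poly_restr_homog k n (phi : 'Hom('rV[K]_k, 'rV[K]_n))
    (y : 'Hom('rV[K]_k, K^o)) w d f :
    (forall v, phi v = y v *: w) -> f \is d.-homog ->
  poly_restr phi f = f.@[w 0] *: lin_poly y ^+ d.
Proof.
move=> phiE /dhomogP fd; rewrite /poly_restr comp_mpolyEX mevalE scaler_suml.
rewrite !big_seq; apply: eq_bigr => e /fd ed; rewrite comp_mpolyX -scalerA.
congr (_ *: _).
have phiX i : tnth [tuple lin_poly (fun v => phi v 0 j) | j < n] i = w 0 i *: lin_poly y.
  rewrite tnth_mktuple -lin_polyZ; apply: lin_polyE => j.
  by rewrite phiE mxE mulrC.
transitivity (\prod_(i < n) ((w 0 i ^+ e i)%:MP * lin_poly y ^+ e i)).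
  apply: eq_bigr => i _.
  by rewrite rmorphXn -exprMn mul_mpolyC; congr (_ ^+ _); apply: phiX.
by rewrite big_split /= -rmorph_prod mul_mpolyC prodrXr -mdegE ed.
Qed.

Lemma lform_proj n (a : 'Hom('rV[K]_n, K^o)) (u : 'rV[K]_n) :
  exists s : 'End('rV[K]_n), forall v, s v = v - a v *: u.
Proof.
pose M : 'M[K]_n := 1%:M - (\row_j (a (delta_mx 0 j)))^T *m u.
exists (linfun (mulmxr M)) => v; rewrite lfunE /= mulmxBr mulmx1; congr (_ - _).
rewrite mulmxA; apply/rowP => i; rewrite !mxE big_ord1 !mxE (row_linE a).
by congr (_ * _); apply: eq_bigr => j _; rewrite !mxE.
Qed.

End Substitution.

(** * Linear forms as prime elements of S *)

Section LinearForms.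
Variables (K : fieldType) (l : nat).
Local Notation S := {mpoly K[l]}.
Implicit Types (a b : 'Hom('rV[K]_l, K^o)).

Lemma meval_lin_poly a (u : 'rV[K]_l) : (lin_poly a).@[u 0] = a u.
Proof.
rewrite raddf_sum (row_linE a); apply: eq_bigr => i _ /=.
by rewrite mevalZ mevalXU mulrC.
Qed.

Lemma lform_neq0P a : reflect (exists u, a u = 1) (a != 0).
Proof.
apply: (iffP idP) => [a0|[u au]]; last first.
  by apply/eqP => a0; move: au; rewrite a0 lfunE => /eqP; rewrite eq_sym oner_eq0.
have [i ai] : exists i, a (delta_mx 0 i) != 0.
  apply/existsP; apply: contraNT a0; rewrite negb_exists => /forallP a0.
  apply/eqP/lfunP => v; rewrite (row_linE a) lfunE big1 //= => j _.
  by have /negPn/eqP-> := a0 j; rewrite scaler0.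
exists ((a (delta_mx 0 i))^-1 *: delta_mx 0 i).
by rewrite linearZ /= -[LHS]/(_ * _) mulVf.
Qed.

Lemma lin_poly_neq0 a : a != 0 -> lin_poly a != 0.
Proof.
case/lform_neq0P => u au; apply/eqP => /(congr1 (meval (u 0))).
by rewrite meval_lin_poly meval0 au => /eqP; rewrite oner_eq0.
Qed.

Lemma divides_lin_poly a b :
  divides (lin_poly a) (lin_poly b) -> (lker a <= lker b)%VS.
Proof.
move=> [c e]; apply/subvP => u; rewrite !memv_ker => /eqP au.
by rewrite -(meval_lin_poly b) e mevalM (meval_lin_poly a) (au : a u = 0) mulr0.
Qed.

(** By [poly_restr_congr], [f] agrees modulo [a] with its pullback along [iota \o rho], which
    factors through the restriction to [ker a]. *)
Lemma divides_restrP k (iota : 'Hom('rV[K]_k, 'rV[K]_l))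
    (rho : 'Hom('rV[K]_l, 'rV[K]_k)) a u f :
    (forall v, v - iota (rho v) = a v *: u) -> (forall w, a (iota w) = 0) ->
  divides (lin_poly a) f <-> poly_restr iota f = 0.
Proof.
move=> sE aiota; split=> [[c ->]|f0].
  rewrite rmorphM /= poly_restr_lin [lin_poly _]big1 ?mulr0 // => i _.
  by rewrite aiota scale0r.
rewrite -[f]subr0 -(rmorph0 (poly_restr rho)) -f0 /= poly_restr_comp.
rewrite -{1}[f]poly_restr_id; apply: (@poly_restr_congr _ _ _ _ _ _ u) => v.
by rewrite id_lfunE comp_lfunE.
Qed.

(* The projection onto ker a along u identifies S/(a) with a subring of S. *)
Lemma prime_lin_poly a : a != 0 -> prime_elt (lin_poly a).
Proof.
move=> a0; have /lform_neq0P[u au] := a0; have [s sE] := lform_proj a u.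
have aP f : divides (lin_poly a) f <-> poly_restr s f = 0.
  apply: (@divides_restrP _ s \1%VF _ u) => v; rewrite sE.
    by rewrite id_lfunE subKr.
  by rewrite linearB linearZ /= au -[_ *: 1]/(_ * 1) mulr1 subrr.
split; first exact: lin_poly_neq0.
  by move/aP; rewrite rmorph1 => /eqP; rewrite oner_eq0.
by move=> f g /aP; rewrite rmorphM => /eqP; rewrite mulf_eq0 => /orP[]/eqP/aP; auto.
Qed.

End LinearForms.

(** * Contractions of forms, and logarithmic forms described by their numerators *)

Section Duality.
Variables (K : fieldType) (l : nat).
Local Notation S := {mpoly K[l]}.
Local Notation F := {fraction S}.
Local Notation space := {vspace 'rV[K]_l}.
Local Notation form := 'Hom('rV[K]_l, K^o).
Implicit Types (p q theta : 'rV[S]_l) (u v : 'rV[K]_l) (a : form).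

(** A row [p] is the numerator of a form [p / Q(A, m)]; [cdot] contracts it with a constant vector
    field, [dot] with a derivation. *)
Definition cdot u p : S := \sum_j u 0 j *: p 0 j.
Definition dot theta p : S := \sum_j theta 0 j * p 0 j.

Lemma cdotDr u p q : cdot u (p + q) = cdot u p + cdot u q.
Proof.
by rewrite -big_split; apply: eq_bigr => j _; rewrite mxE scalerDr.
Qed.

Lemma cdotZr u (c : S) p : cdot u (c *: p) = c * cdot u p.
Proof.
by rewrite mulr_sumr; apply: eq_bigr => j _; rewrite mxE scalerAr.
Qed.

Lemma cdotDl u v p : cdot (u + v) p = cdot u p + cdot v p.
Proof.
by rewrite -big_split; apply: eq_bigr => j _; rewrite mxE scalerDl.
Qed.

Lemma cdotZl c u p : cdot (c *: u) p = c *: cdot u p.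
Proof.
by rewrite scaler_sumr; apply: eq_bigr => j _; rewrite mxE scalerA.
Qed.

Lemma cdotBl u v p : cdot (u - v) p = cdot u p - cdot v p.
Proof. by rewrite cdotDl -[- v]scaleN1r cdotZl scaleN1r. Qed.

Lemma cdot_suml (I : finType) (u : I -> 'rV[K]_l) p :
  cdot (\sum_i u i) p = \sum_i cdot (u i) p.
Proof.
elim/big_rec2: _ => [|i x y _ <-]; last by rewrite cdotDl.
by rewrite /cdot big1 // => j _; rewrite mxE scale0r.
Qed.

Lemma cdot_delta i p : cdot (delta_mx 0 i) p = p 0 i.
Proof.
rewrite /cdot (bigD1 i) //= big1 ?addr0 ?mxE ?eqxx ?scale1r // => j ji.
by rewrite mxE (negPf ji) andbF scale0r.
Qed.

Lemma dotDr theta p q : dot theta (p + q) = dot theta p + dot theta q.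
Proof. by rewrite -big_split; apply: eq_bigr => j _; rewrite mxE mulrDr. Qed.

Lemma dotZr theta c p : dot theta (c *: p) = c * dot theta p.
Proof. by rewrite mulr_sumr; apply: eq_bigr => j _; rewrite mxE mulrCA. Qed.

Lemma dotBr theta p q : dot theta (p - q) = dot theta p - dot theta q.
Proof. by rewrite dotDr -[- q]scaleN1r dotZr mulN1r. Qed.

Lemma dotZl c theta p : dot (c *: theta) p = c * dot theta p.
Proof. by rewrite mulr_sumr; apply: eq_bigr => j _; rewrite mxE mulrA. Qed.

Lemma der_app_lin theta a :
  der_app theta (lin_poly a) = \sum_j a (delta_mx 0 j) *: theta 0 j.
Proof.
apply: eq_bigr => j _; have := ext_d_lin_poly a j; rewrite mxE.
by move/eqP; rewrite tofrac_eq => /eqP->; rewrite mulrC mul_mpolyC.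
Qed.

Lemma der_appDZ c theta theta' f :
  der_app (c *: theta + theta') f = c * der_app theta f + der_app theta' f.
Proof.
rewrite /der_app mulr_sumr -big_split; apply: eq_bigr => j _.
by rewrite !mxE mulrDl mulrA.
Qed.

Lemma der_appZ c theta f : der_app (c *: theta) f = c * der_app theta f.
Proof.
by rewrite /der_app mulr_sumr; apply: eq_bigr => j _; rewrite mxE mulrA.
Qed.

Definition const_der u : 'rV[S]_l := \row_j (u 0 j)%:MP.

Lemma der_app_const u a : der_app (const_der u) (lin_poly a) = (a u : K)%:MP.
Proof.
rewrite der_app_lin (row_linE a) rmorph_sum; apply: eq_bigr => j _.
by rewrite mxE -mul_mpolyC -rmorphM mulrC.
Qed.

(** Each basis vector e_j is [a e_j *: v] plus a vector of [ker a]; so [theta] is [theta(a)] times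
    the direction [v] plus a combination of directions tangent to [ker a]. *)
Lemma dot_lin_decomp a v theta p : a v = 1 ->
  dot theta p = der_app theta (lin_poly a) * cdot v p
    + \sum_j theta 0 j * cdot (delta_mx 0 j - a (delta_mx 0 j) *: v) p.
Proof.
move=> av; rewrite der_app_lin mulr_suml -big_split; apply: eq_bigr => j _ /=.
by rewrite cdotBl cdotZl cdot_delta mulrBr -scalerAl -scalerAr addrC subrK.
Qed.

Variables (A : {fset space}) (m : space -> nat) (alpha : space -> form).

(** The condition on the wedge product with d alpha_L, restated for the numerator: contractions with
    vectors tangent to L are divisible by alpha_L^m(L). *)
Definition poly_log p : Prop := forall L, L \in A -> forall u, alpha L u = 0 ->
  divides (lin_poly (alpha L) ^+ m L) (cdot u p).

Lemma poly_logD p q : poly_log p -> poly_log q -> poly_log (p + q).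
Proof. by move=> hp hq L LA u u0; rewrite cdotDr; apply: dividesD; auto. Qed.

Lemma poly_logZ c p : poly_log p -> poly_log (c *: p).
Proof. by move=> hp L LA u u0; rewrite cdotZr; apply: divides_mull; auto. Qed.

Hypothesis alpha0 : {in A, forall L, alpha L != 0}.

Local Notation Q := (defpoly A m alpha).

Lemma defpoly_neq0 : Q != 0.
Proof.
rewrite /defpoly prodf_seq_neq0; apply/allP => L LA /=.
by rewrite expf_neq0 // lin_poly_neq0 ?alpha0.
Qed.

(** A coefficient of the wedge product with [da] is a contraction with a vector of [ker a], which
    links the two forms of the logarithmic condition. *)
Lemma wedge_lin p a i j :
  wedge ((tofrac Q)^-1 *: map_mx (@tofrac S) p) (ext_d (lin_poly a)) i j =
  (tofrac Q)^-1 *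
    tofrac (cdot (a (delta_mx 0 j) *: delta_mx 0 i - a (delta_mx 0 i) *: delta_mx 0 j) p).
Proof.
rewrite mxE !ext_d_lin_poly !mxE cdotBl !cdotZl !cdot_delta -!mul_mpolyC.
by rewrite rmorphB !rmorphM /= mulrBr -!mulrA ![_ * tofrac _%:MP]mulrC.
Qed.

Lemma log_formP (w : 'rV[F]_l) :
  log_form A m alpha w <->
  exists2 p, w = (tofrac Q)^-1 *: map_mx (@tofrac S) p & poly_log p.
Proof.
have Q0 : tofrac Q != 0 by rewrite tofrac_eq0 defpoly_neq0.
split=> [[[p wE] wL]|[p -> pL]].
  exists p => // L LA u u0.
  have [W WE] := wL L LA.
  have {}WE i j : cdot (alpha L (delta_mx 0 j) *: delta_mx 0 i
      - alpha L (delta_mx 0 i) *: delta_mx 0 j) p = lin_poly (alpha L) ^+ m L * W i j.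
    apply/eqP; rewrite -tofrac_eq; apply/eqP.
    apply: (@mulfI _ (tofrac Q)^-1); first by rewrite invr_eq0.
    by rewrite -wedge_lin -wE WE !mxE rmorphM mulrA; congr (_ * _); apply: mulrC.
  have /lform_neq0P[v av] := alpha0 LA.
  have sumE (x : 'rV[K]_l) : \sum_i x 0 i * alpha L (delta_mx 0 i) = alpha L x.
    by rewrite (row_linE (alpha L) x).
  have -> : cdot u p = \sum_i \sum_j (u 0 i * v 0 j) *: (lin_poly (alpha L) ^+ m L * W i j).
    (* The vectors produced by [wedge_lin] span the kernel of [alpha L]: in this expansion the first
       terms sum to [alpha L v *: u = u] and the second to [alpha L u *: v = 0]. *)
    have uE : u = \sum_i \sum_j (u 0 i * v 0 j) *:
        (alpha L (delta_mx 0 j) *: delta_mx 0 i - alpha L (delta_mx 0 i) *: delta_mx 0 j).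
      transitivity (\sum_i u 0 i *: (delta_mx 0 i - alpha L (delta_mx 0 i) *: v)).
        under eq_bigr => i _ do rewrite scalerBr scalerA.
        rewrite sumrB -row_sum_delta -scaler_suml.
        by rewrite sumE u0 scale0r subr0.
      apply: eq_bigr => i _; under eq_bigr => j _ do rewrite -scalerA.
      rewrite -scaler_sumr; congr (_ *: _).
      under eq_bigr => j _ do rewrite scalerBr !scalerA.
      rewrite sumrB -scaler_suml sumE av scale1r.
      congr (_ - _); rewrite {1}[v]row_sum_delta scaler_sumr.
      by apply: eq_bigr => j _; rewrite scalerA mulrC.
    rewrite {1}uE cdot_suml; apply: eq_bigr => i _; rewrite cdot_suml.
    by apply: eq_bigr => j _; rewrite cdotZl WE.
  apply: divides_sum => i _; apply: divides_sum => j _.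
  by rewrite -mul_mpolyC; apply/divides_mull/divides_mulr/divides_refl.
split; first by exists p.
move=> L LA.
have /fin_all_exists[W WE] ij : exists c, cdot (alpha L (delta_mx 0 ij.2) *: delta_mx 0 ij.1
      - alpha L (delta_mx 0 ij.1) *: delta_mx 0 ij.2) p = c * lin_poly (alpha L) ^+ m L.
  apply: pL => //; rewrite linearB !linearZ /=.
  by rewrite scalerN; apply/eqP; rewrite subr_eq0; apply/eqP/mulrC.
exists (\matrix_(i, j) W (i, j)); apply/matrixP => i j.
rewrite wedge_lin (WE (i, j)) !mxE rmorphM /=.
by rewrite mulrCA mulrC; congr (_ * _); apply: mulrC.
Qed.

End Duality.

(** * The pairing between D(A, m) and Omega^1(A, m), and the dual basis when D(A, m) is free *)

Section DualBasis.
Variables (K : fieldType) (l : nat).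
Local Notation S := {mpoly K[l]}.
Local Notation space := {vspace 'rV[K]_l}.
Local Notation form := 'Hom('rV[K]_l, K^o).
Implicit Types (p q theta : 'rV[S]_l) (u v : 'rV[K]_l) (a : form).

Lemma dot_divides a n theta p : a != 0 ->
    divides (lin_poly a ^+ n) (der_app theta (lin_poly a)) ->
    (forall u, a u = 0 -> divides (lin_poly a ^+ n) (cdot u p)) ->
  divides (lin_poly a ^+ n) (dot theta p).
Proof.
case/lform_neq0P => v av atheta ap.
rewrite (dot_lin_decomp theta p av).
apply: dividesD; first exact: divides_mulr.
apply: divides_sum => j _; apply/divides_mull/ap.
rewrite linearB linearZ /= av -[_ *: 1]/(_ * 1) mulr1 subrr //.
Qed.

Variables (A : {fset space}) (m : space -> nat) (alpha : space -> form).
Hypothesis alpha0 : {in A, forall L, alpha L != 0}.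
Hypothesis alphaN : {in A &, forall L M, L != M ->
  ~ divides (lin_poly (alpha L)) (lin_poly (alpha M))}.

Local Notation Q := (defpoly A m alpha).
Local Notation D := (log_der A m alpha).

Lemma defpoly_dvd f :
  {in A, forall L, divides (lin_poly (alpha L) ^+ m L) f} -> divides Q f.
Proof.
move=> Af; apply: (@prod_prime_pow_dvd _ _ A (fun L => lin_poly (alpha L))) => // L LA.
exact/prime_lin_poly/alpha0.
Qed.

(** The pairing of a logarithmic derivation with the form [p / Q] thus has values in S: divisibility
    is checked at one hyperplane at a time with [dot_divides]. *)
Lemma defpoly_dvd_dot theta p : D theta -> poly_log A m alpha p -> divides Q (dot theta p).
Proof.
move=> Dt pL; apply: defpoly_dvd => L LA.
by apply: dot_divides; [exact: alpha0|exact: Dt|exact: pL].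
Qed.

Lemma defpolyD1 L : L \in A ->
  Q = lin_poly (alpha L) ^+ m L * defpoly (A `\ L) m alpha.
Proof. by move=> LA; rewrite /defpoly (big_fsetD1 L). Qed.

Lemma defpoly_divides L : L \in A -> divides (lin_poly (alpha L) ^+ m L) Q.
Proof.
move=> LA; rewrite (defpolyD1 LA); exact/divides_mulr/divides_refl.
Qed.

Lemma log_der_defpoly theta : D (Q *: theta).
Proof.
by move=> L LA; rewrite der_appZ; apply/divides_mulr/defpoly_divides.
Qed.

(** A direction tangent to L only needs the factors of [Q] coming from the other hyperplanes. This
    yields the condition along L for the forms built in [dual_basis_exists]. *)
Lemma log_der_const L u : L \in A -> alpha L u = 0 ->
  D (defpoly (A `\ L) m alpha *: const_der u).
Proof.
move=> LA u0 M MA; rewrite der_appZ.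
have [->|ML] := eqVneq M L.
  apply: divides_mull; rewrite der_app_const u0 mpolyC0; exact: divides0.
apply: divides_mulr; rewrite /defpoly (big_fsetD1 M) ?in_fsetD1 ?ML //=; exact/divides_mulr/divides_refl.
Qed.

Lemma log_der_comb n (b : 'I_n -> 'rV[S]_l) c :
  (forall i, D (b i)) -> D (\sum_i c i *: b i).
Proof.
move=> bD L LA; elim/big_ind: _ => [|x y [f fE] [g gE]|i _].
- by exists 0; rewrite mul0r [der_app _ _]big1 // => j _; rewrite mxE mul0r.
- exists (f + g); rewrite -[x]scale1r der_appDZ mul1r fE gE mulrDl //.
- by have [f fE] := bD i L LA; exists (c i * f); rewrite der_appZ fE mulrA.
Qed.

Variables (n : nat) (b : n.-tuple 'rV[S]_l).
Hypothesis bD : is_basis D b.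

(** Uniqueness in [is_basis] concerns members of [D] only, so the combination is first placed in
    [D]. *)
Lemma basis_inj (c d : 'I_n -> S) :
  \sum_i c i *: tnth b i = \sum_i d i *: tnth b i -> c =1 d.
Proof.
case: bD => bin bex e; have [e0 [_ eu]] := bex _ (log_der_comb c bin).
have ec : e0 = [ffun i => c i] by apply: eu; apply: eq_bigr => i _; rewrite ffunE.
have ed : e0 = [ffun i => d i].
  by apply: eu; rewrite e; apply: eq_bigr => i _; rewrite ffunE.
by move=> i; move/ffunP/(_ i): (etrans (esym ec) ed); rewrite !ffunE.
Qed.

Lemma basis_coord theta : D theta -> exists c : 'I_n -> S, theta = \sum_i c i *: tnth b i.
Proof. by case: bD => _ bex /bex[c [-> _]]; exists c. Qed.

(** Every functional on D(A, m) is the pairing with a form of Omega^1(A, m). As [Q] d/dx_j lies in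
    [D], its value there is the j-th entry of [p]. For [u] tangent to L, [Q] d/du is alpha_L^m(L)
    times a member of [D], whence the logarithmic condition. *)
Lemma dual_basis_exists (c : 'I_n -> S) : exists2 p, poly_log A m alpha p &
  forall i, dot (tnth b i) p = c i * Q.
Proof.
have /fin_all_exists[M ME] j := basis_coord (log_der_defpoly (const_der (delta_mx 0 j))).
have Qrow theta : Q *: theta = \sum_i (\sum_j theta 0 j * M j i) *: tnth b i.
  under eq_bigr => i _ do rewrite scaler_suml.
  rewrite exchange_big /=.
  under eq_bigr => j _ do under eq_bigr => i _ do rewrite -scalerA.
  under eq_bigr => j _ do rewrite -scaler_sumr -ME scalerA mulrC -scalerA.
  rewrite -scaler_sumr; congr (_ *: _); apply/rowP => i.
  rewrite summxE (bigD1 i) //= big1 => [|j ji]; rewrite !mxE ?eqxx.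
    by rewrite mpolyC1 mulr1 addr0.
  by rewrite eq_sym (negPf ji) mpolyC0 mulr0.
exists (\row_j \sum_i M j i * c i) => [L LA u u0|k].
  have [N NE] := basis_coord (log_der_const LA u0).
  have uM : (fun i => \sum_j u 0 j *: M j i) =1 (fun i => lin_poly (alpha L) ^+ m L * N i).
    apply: basis_inj.
    under [RHS]eq_bigr => i _ do rewrite -scalerA.
    rewrite -scaler_sumr -NE scalerA -defpolyD1 // Qrow.
    by apply: eq_bigr => i _; congr (_ *: _); apply: eq_bigr => j _; rewrite mxE mul_mpolyC.
  have -> : cdot u (\row_j \sum_i M j i * c i)
      = \sum_i (lin_poly (alpha L) ^+ m L * N i) * c i.
    under [RHS]eq_bigr => i _ do rewrite -uM mulr_suml.
    rewrite exchange_big; apply: eq_bigr => j _; rewrite mxE scaler_sumr.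
    by apply: eq_bigr => i _; rewrite scalerAl.
  by apply: divides_sum => i _; rewrite -mulrA; apply/divides_mulr/divides_refl.
(* [Qrow] expands [Q *: tnth b k] in the basis; uniqueness of coordinates leaves [Q] on the diagonal
   and 0 elsewhere. *)
have bk : (fun i => \sum_j tnth b k 0 j * M j i) =1 (fun i => (i == k)%:R * Q).
  apply: basis_inj; rewrite -Qrow (bigD1 k) //= big1 => [|i ik].
    by rewrite eqxx mul1r addr0.
  by rewrite (negPf ik) mul0r scale0r.
transitivity (\sum_i ((i == k)%:R * Q) * c i).
  under [RHS]eq_bigr => i _ do rewrite -bk mulr_suml.
  rewrite exchange_big; apply: eq_bigr => j _; rewrite mxE mulr_sumr.
  by apply: eq_bigr => i _; rewrite mulrA.
rewrite (bigD1 k) //= big1 => [|i ik]; first by rewrite eqxx mul1r addr0 mulrC.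
by rewrite (negPf ik) !mul0r.
Qed.

(** D(A, m) contains [Q] d/dx_j for every j, hence separates forms. *)
Lemma dot_basis_inj p : (forall i, dot (tnth b i) p = 0) -> p = 0.
Proof.
move=> bp; apply/rowP => j; rewrite mxE.
have [c cE] := basis_coord (log_der_defpoly (delta_mx 0 j)).
apply: (mulfI (defpoly_neq0 m alpha0)); rewrite mulr0.
have <- : dot (Q *: delta_mx 0 j) p = Q * p 0 j.
  rewrite dotZl; congr (_ * _); rewrite /dot (bigD1 j) //= big1 => [|i ij].
    by rewrite mxE !eqxx mul1r addr0.
  by rewrite mxE (negPf ij) andbF mul0r.
rewrite cE /dot.
under eq_bigr => i _ do rewrite summxE mulr_suml.
rewrite exchange_big big1 // => k _.
transitivity (c k * dot (tnth b k) p); last by rewrite bp mulr0.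
by rewrite mulr_sumr; apply: eq_bigr => i _; rewrite mxE mulrA.
Qed.

End DualBasis.

(** * Defining forms of distinct hyperplanes are nonzero and pairwise non-associate *)

Section DefiningForms.
Variables (K : fieldType) (l : nat) (A : {fset {vspace 'rV[K]_l}}).
Variable alpha : {vspace 'rV[K]_l} -> 'Hom('rV[K]_l, K^o).
Hypotheses (A_arr : arrangement A) (alphaP : defining_forms A alpha).

Lemma defining_form_neq0 : {in A, forall L, alpha L != 0}.
Proof.
move=> L LA; apply/eqP => a0; have := A_arr LA.
have -> : L = fullv.
  rewrite -(alphaP LA) a0; apply/vspaceP => u.
  by rewrite memv_ker lfunE eqxx memvf.
by rewrite dimvf /dim /= mul1n => /esym/n_Sn.
Qed.

Lemma defining_form_ndvd : {in A &, forall L M, L != M ->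
  ~ divides (lin_poly (alpha L)) (lin_poly (alpha M))}.
Proof.
move=> L M LA MA LM /divides_lin_poly; rewrite !alphaP // => sLM.
move: LM; rewrite eqEdim sLM /= -ltnNge.
by rewrite -ltnS (A_arr LA) (A_arr MA) ltnn.
Qed.

End DefiningForms.

(** * Lowering the multiplicity of H by one, and restriction to H in terms of numerators *)

Section Deletion.
Variables (K : fieldType) (l : nat).
Local Notation S := {mpoly K[l]}.
Local Notation space := {vspace 'rV[K]_l}.
Variables (A : {fset space}) (m : space -> nat).
Variable alpha : space -> 'Hom('rV[K]_l, K^o).
Hypothesis alpha0 : {in A, forall L, alpha L != 0}.
Hypothesis alphaN : {in A &, forall L M, L != M ->
  ~ divides (lin_poly (alpha L)) (lin_poly (alpha M))}.
Variable H : space.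
Hypotheses (HA : H \in A) (mH : (0 < m H)%N).
Local Notation a := (lin_poly (alpha H)).
Local Notation m' := (mult_pred m H).
Local Notation Q := (defpoly A m alpha).
Local Notation Q0 := (defpoly (A `\ H) m alpha).
Implicit Types (p q : 'rV[S]_l).

Lemma mult_predH : m' H = (m H).-1.
Proof. by rewrite /mult_pred eqxx subn1. Qed.

Lemma mult_predN L : L != H -> m' L = m L.
Proof. by move=> LH; rewrite /mult_pred (negPf LH) subn0. Qed.

Lemma form_pow_multS : a ^+ m H = a * a ^+ (m H).-1.
Proof. by rewrite -exprS prednK. Qed.

Lemma defpoly_pred : defpoly A m' alpha = a ^+ (m H).-1 * Q0.
Proof.
rewrite (defpolyD1 _ _ HA) mult_predH; congr (_ * _).
rewrite /defpoly !big_seq; apply: eq_bigr => L.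
by rewrite in_fsetD1 => /andP[LH _]; rewrite mult_predN.
Qed.

Lemma form_neq0 : a != 0.
Proof. by apply/lin_poly_neq0/alpha0. Qed.

(** Since Q(A, m) = [a] Q(A, m'), the form [p / Q(A, m')] has numerator [a *: p] over Q(A, m). With
    [poly_log_mul], Omega^1(A, m') is the part of Omega^1(A, m) whose numerators are divisible by
    [a]. *)
Lemma poly_log_div p : poly_log A m alpha (a *: p) -> poly_log A m' alpha p.
Proof.
move=> pL L LA u u0; have := pL L LA u u0; rewrite cdotZr.
have [->|LH] := eqVneq L H.
  rewrite mult_predH form_pow_multS; exact/divides_mul2l/form_neq0.
rewrite mult_predN //; apply: prime_pow_coprime; last exact: alphaN.
exact/prime_lin_poly/alpha0.
Qed.

Lemma poly_log_mul p : poly_log A m' alpha p -> poly_log A m alpha (a *: p).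
Proof.
move=> pL L LA u u0; have := pL L LA u u0; rewrite cdotZr.
have [->|LH] := eqVneq L H.
  by rewrite mult_predH form_pow_multS => -[f ->]; exists f; rewrite mulrCA.
by rewrite mult_predN // => pu; apply: divides_mull.
Qed.

Lemma poly_log_unpred p : poly_log A m' alpha p ->
    (forall u, alpha H u = 0 -> divides (a ^+ m H) (cdot u p)) ->
  poly_log A m alpha p.
Proof.
move=> pL pH L LA u; have [->|LH] := eqVneq L H; first exact: pH.
by move/(pL L LA); rewrite mult_predN.
Qed.

Variables (k : nat) (iota : 'Hom('rV[K]_k, 'rV[K]_l)) (rho : 'Hom('rV[K]_l, 'rV[K]_k)).
Hypotheses (kerH : lker (alpha H) = H) (iota_img : limg iota = H).
Hypothesis iotaK : (rho \o iota)%VF = \1%VF.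
Local Notation Sbar := {mpoly K[k]}.
Local Notation res := (poly_restr iota).
Local Notation lift := (poly_restr rho).

Lemma alpha_iota w : alpha H (iota w) = 0.
Proof. by apply/eqP; rewrite -memv_ker kerH -iota_img memv_img ?memvf. Qed.

Lemma rho_iota w : rho (iota w) = w.
Proof. by rewrite -comp_lfunE iotaK id_lfunE. Qed.

Lemma alpha_ker_iota u : alpha H u = 0 -> exists w, u = iota w.
Proof.
move/eqP; rewrite -memv_ker kerH -iota_img => /memv_imgP[w _ ->]; by exists w.
Qed.

(** [iota \o rho] is a projection onto H; any vector on which [alpha H] is 1, minus its projection,
    spans the kernel of that projection. *)
Lemma normal_vector : exists2 v, alpha H v = 1 &
  forall u, u - iota (rho u) = alpha H u *: v.
Proof.
have /lform_neq0P[v0 av0] := alpha0 HA.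
exists (v0 - iota (rho v0)); first by rewrite linearB /= alpha_iota subr0.
move=> u; have [w uw] : exists w, u - alpha H u *: v0 = iota w.
  apply: alpha_ker_iota; rewrite linearB linearZ /= av0.
  by rewrite -[_ *: 1]/(_ * 1) mulr1 subrr.
have uE : u = iota w + alpha H u *: v0 by rewrite -uw subrK.
have -> : iota (rho u) = iota w + alpha H u *: iota (rho v0).
  by rewrite {1}uE !linearD !linearZ /= rho_iota.
by rewrite {1}uE opprD addrACA subrr add0r scalerBr.
Qed.

Lemma res_eq0 f : divides a f <-> res f = 0.
Proof.
have [v _ vE] := normal_vector.
exact: (divides_restrP _ vE alpha_iota).
Qed.

Lemma restr_liftK f : res (lift f) = f.
Proof. by rewrite poly_restr_comp iotaK poly_restr_id. Qed.

Lemma cdot_iota w p : cdot (iota w) p = \sum_i w 0 i *: cdot (iota (delta_mx 0 i)) p.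
Proof.
rewrite (row_linE iota) cdot_suml.
by apply: eq_bigr => i _; rewrite cdotZl.
Qed.

(* [num_restr p s]: the form p / Q(A, m') restricts to s / res Q0 on H. *)
Definition num_restr p (s : 'rV[Sbar]_k) : Prop :=
  forall i, exists2 t, cdot (iota (delta_mx 0 i)) p = a ^+ (m H).-1 * t & s 0 i = res t.

Lemma num_restr_inj p s s' : num_restr p s -> num_restr p s' -> s = s'.
Proof.
move=> ps ps'; apply/rowP => i.
have [[t e ->] [t' e' ->]] := (ps i, ps' i).
by congr res; apply: (mulfI (expf_neq0 (m H).-1 form_neq0)); rewrite -e -e'.
Qed.

Lemma num_restrD p q s s' :
  num_restr p s -> num_restr q s' -> num_restr (p + q) (s + s').
Proof.
move=> ps qs i; have [[t e te] [t' e' te']] := (ps i, qs i).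
by exists (t + t'); rewrite ?cdotDr ?e ?e' ?mulrDr // mxE rmorphD te te'.
Qed.

Lemma num_restrZ c p s : num_restr p s -> num_restr (c *: p) (res c *: s).
Proof.
move=> ps i; have [t e te] := ps i.
by exists (c * t); rewrite ?cdotZr ?e 1?mulrCA // mxE rmorphM te.
Qed.

Lemma num_restr_exists p : poly_log A m' alpha p -> exists s, num_restr p s.
Proof.
move=> pL.
have /fin_all_exists[t tE] i : exists t, cdot (iota (delta_mx 0 i)) p = t * a ^+ (m H).-1.
  by have := pL H HA _ (alpha_iota (delta_mx 0 i)); rewrite mult_predH.
by exists (\row_i res (t i)) => i; exists (t i); rewrite ?mxE // tE mulrC.
Qed.

(** The kernel of the restriction is [a] Omega^1(A, m): vanishing on H supplies the one factor [a]
    that tangential contractions lack, and [p / Q(A, m')] is [a] times [p / Q(A, m)]. *)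
Lemma num_restr0P p : poly_log A m' alpha p ->
  num_restr p 0 <-> poly_log A m alpha p.
Proof.
move=> pL; split=> [p0|pL' i].
  apply: poly_log_unpred => // u /alpha_ker_iota[w ->].
  rewrite cdot_iota; apply: divides_sum => i _; rewrite -mul_mpolyC; apply: divides_mull.
  have [t -> /esym] := p0 i; rewrite mxE => /res_eq0[f ->].
  by exists f; rewrite form_pow_multS mulrCA [a * _]mulrC.
have [f fE] := pL' H HA _ (alpha_iota (delta_mx 0 i)).
exists (f * a); first by rewrite fE form_pow_multS mulrA mulrC.
by rewrite mxE; apply/esym/res_eq0; exists f.
Qed.

Lemma poly_log_pred p : poly_log A m alpha p -> poly_log A m' alpha p.
Proof.
move=> pL L LA u u0; apply: divides_trans (pL L LA u u0).
by exists (lin_poly (alpha L) ^+ (m L - m' L)); rewrite -exprD subnK // leq_subr.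
Qed.

(** In the coordinates [alpha H], [rho] of V, the coefficient of d alpha_H is the contraction with
    the normal vector, and the others are [a ^+ (m H).-1 * t i] over Q(A, m'), that is [t i / Q0],
    without pole along H. *)
Lemma form_restr_num p s (eta : 'rV[{fraction Sbar}]_k) : res Q0 != 0 ->
    num_restr p s -> (forall i, eta 0 i = tofrac (s 0 i) / tofrac (res Q0)) ->
  form_restr iota (alpha H) rho
    ((tofrac (defpoly A m' alpha))^-1 *: map_mx (@tofrac S) p) eta.
Proof.
move=> rQ0 ps etaE; have [v av vE] := normal_vector.
have /fin_all_exists2[t tE st] := ps.
have Q00 : tofrac Q0 != 0.
  by rewrite tofrac_eq0; apply: contraNneq rQ0 => ->; rewrite rmorph0.
have a0 : tofrac (a ^+ (m H).-1) != 0 by rewrite tofrac_eq0 expf_neq0 ?form_neq0.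
exists ((tofrac (defpoly A m' alpha))^-1 * tofrac (cdot v p)).
exists (fun i => tofrac (t i) / tofrac Q0); split=> [|i]; last first.
  by exists (t i), Q0; rewrite rQ0 etaE st.
apply/rowP => j; rewrite !mxE summxE.
under eq_bigr => i _ do rewrite mxE ext_d_lin_poly.
have := ext_d_lin_poly (alpha H) j; rewrite mxE => ->.
have -> : p 0 j = (alpha H (delta_mx 0 j))%:MP * cdot v p
    + a ^+ (m H).-1 * \sum_i (rho (delta_mx 0 j) 0 i)%:MP * t i.
  rewrite -{1}(cdot_delta j p) -{1}[delta_mx 0 j](subrK (iota (rho (delta_mx 0 j)))) vE.
  rewrite cdotDl cdotZl mul_mpolyC cdot_iota mulr_sumr; congr (_ + _).
  by apply: eq_bigr => i _; rewrite tE mul_mpolyC scalerAr.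
rewrite rmorphD !rmorphM /= mulrDr; congr (_ + _).
  by rewrite -[RHS]mulrA; congr (_ * _); exact: mulrC.
rewrite defpoly_pred rmorphM invfM mulrACA mulVf // mul1r rmorph_sum mulr_sumr.
by apply: eq_bigr => i _; rewrite rmorphM mulrCA mulrC; congr (_ * _); exact: mulrC.
Qed.

Hypothesis A_free : free_multiarrangement A m alpha.
Variables (B : {fset {vspace 'rV[K]_k}}) (d : {vspace 'rV[K]_k} -> nat).
Variable beta : {vspace 'rV[K]_k} -> 'Hom('rV[K]_k, K^o).
Hypothesis beta0 : {in B, forall X, beta X != 0}.
Hypothesis betaN : {in B &, forall X Y, X != Y ->
  ~ divides (lin_poly (beta X)) (lin_poly (beta Y))}.

(* Omega^1(A, m) / a Omega^1(A, m) is a free module over S / (a) that contains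
   the image of Omega^1(A, m'), with torsion-free quotient. *)
Lemma num_restr_glue (q : 'rV[Sbar]_k) : B != fset0 ->
    (forall X, X \in B -> exists p s, [/\ poly_log A m' alpha p, num_restr p s &
      lin_poly (beta X) ^+ d X *: s = res Q0 *: q]) ->
  exists p s, [/\ poly_log A m' alpha p, num_restr p s &
    defpoly B d beta *: s = res Q0 *: q].
Proof.
case/fset0Pn => X XB loc.
have [n [b bD]] := A_free.
(* [c i] is the value of the form [p / Q(A, m')] on the basis element [b i]. *)
have coef p : poly_log A m' alpha p -> exists c : 'I_n -> S,
    forall i, a * dot (tnth b i) p = c i * Q.
  move=> pL; have /fin_all_exists[c cE] i : divides Q (a * dot (tnth b i) p).
    rewrite -dotZr; apply: (defpoly_dvd_dot alpha0 alphaN); last exact: poly_log_mul.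
    by case: bD.
  by exists c.
have [pX [sX [pXL pXs sXE]]] := loc X XB.
have [c cE] := coef _ pXL.
pose f := defpoly (B `\ X) d beta.
have Q_neq0 := defpoly_neq0 m alpha0.
have BX0 : {in B `\ X, forall Y, beta Y != 0}.
  by move=> Y /fsetD1P[_ YB]; apply: beta0.
have f_dvd i : divides f (res (c i)).
  apply: defpoly_dvd => // [Y Z /fsetD1P[_ YB] /fsetD1P[_ ZB]|Y /fsetD1P[YX YB]].
    exact: betaN.
  have [pY [sY [pYL pYs sYE]]] := loc Y YB.
  have [e eE] := coef _ pYL.
  pose bX := lift (lin_poly (beta X) ^+ d X); pose bY := lift (lin_poly (beta Y) ^+ d Y).
  (* Both [bX *: pX] and [bY *: pY] restrict to [res Q0 *: q], so their difference is in the kernel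
     and its coordinates vanish modulo [a]. Thus on H the coordinates of [pX], multiplied by a power
     of beta_X, are divisible by the power of beta_Y. *)
  have zL : poly_log A m alpha (bX *: pX + (- bY) *: pY).
    apply/num_restr0P; first by apply: poly_logD; apply: poly_logZ.
    have := num_restrD (num_restrZ bX pXs) (num_restrZ (- bY) pYs).
    by rewrite rmorphN /= !restr_liftK [_ *: sY]scaleNr sXE sYE subrr.
  have [g gE] := defpoly_dvd_dot alpha0 alphaN (bD.1 i) zL.
  have {gE} : bX * c i - bY * e i = g * a.
    apply: (mulIf Q_neq0); rewrite mulrBl -!mulrA -cE -eE (mulrCA g) -gE.
    by rewrite dotDr !dotZr mulNr mulrBr !(mulrCA a).
  move/(congr1 res); rewrite rmorphB !rmorphM /= !restr_liftK.
  have -> : res a = 0 by apply/res_eq0/divides_refl.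
  rewrite mulr0 => /eqP; rewrite subr_eq0 => /eqP bce.
  apply: (@prime_pow_coprime _ _ (lin_poly (beta X) ^+ d X)).
  - exact/prime_lin_poly/beta0.
  - by apply: prime_ndvd_exp; [exact/prime_lin_poly/beta0 | apply: betaN].
  - by rewrite bce; apply/divides_mulr/divides_refl.
have /fin_all_exists[w wE] := f_dvd.
(* The candidate: the form of Omega^1(A, m) whose coordinates lift those of [pX] divided by [f]. *)
have [p pL pE] := dual_basis_exists bD (fun i => lift (w i)).
have /fin_all_exists[e eE] i : exists e, lift f * lift (w i) - c i = e * a.
  by apply/res_eq0; rewrite rmorphB rmorphM /= !restr_liftK wE mulrC subrr.
have [z zL zE] := dual_basis_exists bD e.
(* The correction [z] absorbs the discrepancy modulo [a]; both sides have the same pairings with the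
   basis of D(A, m). *)
have fp : lift f *: p = a *: (pX + z).
  apply/eqP; rewrite -subr_eq0; apply/eqP/(dot_basis_inj alpha0 bD) => i.
  rewrite dotBr !dotZr dotDr pE zE mulrDr cE !mulrA -mulrDl -mulrBl.
  by rewrite opprD addrA eE [a * _]mulrC subrr mul0r.
have f0 : f != 0 by apply: defpoly_neq0.
(* Torsion-freeness: [lift f] restricts to [f], which is nonzero, so the prime [a] must divide [p];
   the candidate then lies in Omega^1(A, m'). *)
have /fin_all_exists[p' p'E] j : divides a (p 0 j).
  have [_ _ /(_ (lift f) (p 0 j))[]] := prime_lin_poly (alpha0 HA).
  - have /rowP/(_ j) := fp; rewrite !mxE => ->; exact/divides_mulr/divides_refl.
  - by move/res_eq0; rewrite restr_liftK => /eqP; rewrite (negPf f0).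
  - by [].
pose r := \row_j p' j.
have pr : p = a *: r by apply/rowP => j; rewrite !mxE p'E mulrC.
have rL : poly_log A m' alpha r by apply: poly_log_div; rewrite -pr.
have [s rs] := num_restr_exists rL.
exists r, s; split=> //.
have fr : lift f *: r = pX + z.
  apply/rowP => j; apply: (mulfI form_neq0); have /rowP/(_ j) := fp.
  by rewrite pr !mxE mulrCA.
(* Over Q(A, m') the numerator [z] gives [a] times a form of Omega^1(A, m), so it restricts to zero
   and [f *: s] is the restriction of [pX]. *)
have zs : num_restr z 0 by apply/num_restr0P => //; apply: poly_log_pred.
have := num_restrD pXs zs; rewrite addr0 -fr => h.
have := num_restr_inj (num_restrZ (lift f) rs) h; rewrite restr_liftK => fs.
by rewrite (defpolyD1 _ _ XB) -scalerA fs sXE.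
Qed.

End Deletion.

(** * Pullback of polynomial 1-forms, and linear algebra in the plane *)

Section PullbackRow.
Variables (K : fieldType) (k n : nat).
Implicit Types phi : 'Hom('rV[K]_k, 'rV[K]_n).

(* Pullback along phi of the 1-form \sum_i r_i dx_i. *)
Definition pull_row phi (r : 'rV[{mpoly K[n]}]_n) : 'rV[{mpoly K[k]}]_k :=
  \row_j poly_restr phi (cdot (phi (delta_mx 0 j)) r).

Lemma cdot_pull_row phi u r :
  cdot u (pull_row phi r) = poly_restr phi (cdot (phi u) r).
Proof.
rewrite {2}[u]row_sum_delta linear_sum cdot_suml rmorph_sum /=.
by apply: eq_bigr => j _; rewrite mxE linearZ /= cdotZl poly_restrZ.
Qed.

End PullbackRow.

Lemma lform_proportional (K : fieldType) l (f g : 'Hom('rV[K]_l, K^o)) :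
  g != 0 -> lker f = lker g -> exists2 c : K, c != 0 & forall u, f u = c * g u.
Proof.
case/lform_neq0P => v gv fg.
have kfg u : (f u == 0) = (g u == 0) by rewrite -!memv_ker fg.
exists (f v) => [|u]; first by rewrite kfg gv oner_eq0.
have: f (u - g u *: v) == 0.
  by rewrite kfg linearB linearZ /= gv -[_ *: 1]/(_ * 1) mulr1 subrr.
by rewrite linearB linearZ /= subr_eq0 => /eqP->; apply: mulrC.
Qed.

(** Cramer's rule: with [w] chosen so that [g u = det(u, w)], and [y u = det(v, u)], the
    normalisation [g v = 1] says [det(v, w) = 1]. *)
Lemma plane_coord (K : fieldType) (g : 'Hom('rV[K]_2, K^o)) : g != 0 ->
  exists (v w : 'rV[K]_2) (y : 'Hom('rV[K]_2, K^o)),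
    g w = 0 /\ forall u, u = g u *: v + y u *: w.
Proof.
case/lform_neq0P => v gv.
pose f (u : 'rV[K]_2) : K^o := v 0 0 * u 0 1 - v 0 1 * u 0 0.
have f_lin : linear f by move=> c u u'; rewrite /f !mxE -[_ *: _]/(_ * _); ring.
pose fM := GRing.isLinear.Build K 'rV[K]_2 K^o *:%R f f_lin.
pose fL : {linear 'rV[K]_2 -> K^o} := HB.pack f fM.
have gE u : g u = u 0 0 * g (delta_mx 0 0) + u 0 1 * g (delta_mx 0 1).
  by rewrite (row_linE g) big_ord_recl big_ord1; congr (_ + u 0 _ * g (delta_mx 0 _)); apply/val_inj.
pose w : 'rV[K]_2 := \row_j (if j == 0 then - g (delta_mx 0 1) else g (delta_mx 0 0)).
exists v, w, (linfun fL); split.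
  by rewrite gE !mxE /=; ring.
move: gv; rewrite gE => gv u; apply/rowP => j; rewrite !mxE lfunE /= /f gE.
have [->|] := eqVneq j 0.
  by rewrite -[LHS]mulr1 -gv; ring.
case: j => -[|[|//]] // j1 _; have -> : Ordinal j1 = 1 by apply/val_inj.
by rewrite -[LHS]mulr1 -gv; ring.
Qed.

(** * The dual of theta_X in a rank 2 arrangement *)

Section Planar.
Variables (K : fieldType).
Local Notation S := {mpoly K[2]}.
Local Notation space := {vspace 'rV[K]_2}.
Variables (A : {fset space}) (m : space -> nat).
Variable gamma : space -> 'Hom('rV[K]_2, K^o).
Hypothesis gamma0 : {in A, forall L, gamma L != 0}.
Hypothesis gammaN : {in A &, forall L M, L != M ->
  ~ divides (lin_poly (gamma L)) (lin_poly (gamma M))}.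
Variable H : space.
Hypotheses (HA : H \in A) (mH : (0 < m H)%N).
Local Notation a := (lin_poly (gamma H)).
Local Notation Q := (defpoly A m gamma).
Local Notation Q0 := (defpoly (A `\ H) m gamma).
Variables theta phi : 'rV[S]_2.
Hypothesis bD : is_basis (log_der A m gamma) [tuple theta; phi].
Hypothesis aphi : der_dvd a phi.

(* The witness is the element dual to theta in the basis of Omega^1(A, m) dual
   to (theta, phi). *)
Lemma planar_form v w (y : 'Hom('rV[K]_2, K^o)) :
    gamma H w = 0 -> (forall u, u = gamma H u *: v + y u *: w) ->
  exists r t, [/\ poly_log A (mult_pred m H) gamma r,
    cdot w r = t * a ^+ (m H).-1 &
    divides a (Q0 - der_app theta (lin_poly y) * t)].
Proof.
move=> gw uE.
have [p pL pE] := dual_basis_exists bD (fun i => (i == ord0)%:R).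
have /= := pE ord0; have /= := pE ord_max.
rewrite !(tnth_nth 0) /= mul1r mul0r => phip thetap.
have dotE th q : dot th q = der_app th (lin_poly (gamma H)) * cdot v q
    + der_app th (lin_poly y) * cdot w q.
  rewrite !der_app_lin !mulr_suml -big_split; apply: eq_bigr => j _ /=.
  rewrite -(cdot_delta j q) {1}[delta_mx 0 j]uE cdotDl !cdotZl mulrDr.
  by rewrite -!scalerAl -!scalerAr.
have a0 : a != 0 by apply/lin_poly_neq0/gamma0.
have am0 n : a ^+ n != 0 by apply: expf_neq0.
have apr : prime_elt a by apply/prime_lin_poly/gamma0.
have amE : a ^+ m H = a * a ^+ (m H).-1 by apply: form_pow_multS.
have [t tE] := pL H HA w gw.
have [phi' phiE] := aphi.
have {}phip : dot phi' p = 0.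
  by apply: (mulfI a0); rewrite mulr0 -phip phiE dotZl.
have [phi1 phi1E] : divides (a ^+ (m H).-1) (der_app phi' a).
  apply: (divides_mul2l a0); rewrite -amE -der_appZ -phiE.
  by have := bD.1 ord_max; rewrite (tnth_nth 0) /=; apply.
have [g gE] : divides (a ^+ m H) (der_app theta a).
  by have := bD.1 ord0; rewrite (tnth_nth 0) /=; apply.
(* Otherwise [phi'] would be logarithmic, and [phi = a *: phi'] could not be a basis element because
   [a] is not a unit. *)
have nphi1 : ~ divides a phi1.
  case=> f fE.
  have phi'D : log_der A m gamma phi'.
    move=> L LA; have [->|LH] := eqVneq L H.
      by exists f; rewrite phi1E fE amE mulrA.
    apply: (@prime_pow_coprime _ _ a); first exact/prime_lin_poly/gamma0.
      exact: gammaN.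
    rewrite -der_appZ -phiE.
    by have := bD.1 ord_max; rewrite (tnth_nth 0) /=; apply.
  have [c cE] := basis_coord bD phi'D.
  have /(_ ord_max)/= : (fun i : 'I_2 => (i == ord_max)%:R) =1 (fun i => a * c i).
    apply: (basis_inj bD); under [RHS]eq_bigr => i _ do rewrite -scalerA.
    rewrite -scaler_sumr -cE -phiE big_ord_recl big_ord1 !(tnth_nth 0) /=.
    by rewrite scale0r add0r scale1r.
  by case: apr => _ a1 _ a1E; apply: a1; exists (c ord_max); rewrite mulrC -a1E.
(* Expanding [dot phi' p = 0] along [v] and [w] and cancelling [a ^+ (m H).-1] shows that [a]
   divides [phi1 * cdot v p]. So [p] is divisible by [a] in both directions. *)
have [p1 p1E] : divides a (cdot v p).
  case: apr => _ _ /(_ phi1 (cdot v p))[] //.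
  move/eqP: phip; rewrite dotE phi1E tE amE addr_eq0 => /eqP e.
  exists (- (der_app phi' (lin_poly y) * t)); apply: (mulIf (am0 (m H).-1)).
  by rewrite mulrAC e !mulNr !mulrA.
pose r : 'rV[S]_2 :=
  \row_j (gamma H (delta_mx 0 j) *: p1 + y (delta_mx 0 j) *: (t * a ^+ (m H).-1)).
have pr : p = a *: r.
  apply/rowP => j; rewrite !mxE -(cdot_delta j p) {1}[delta_mx 0 j]uE cdotDl !cdotZl.
  by rewrite p1E tE amE mulrDr -!scalerAr [p1 * a]mulrC mulrCA.
exists r, t; split.
- by apply: poly_log_div => //; rewrite -pr.
- by apply: (mulfI a0); rewrite -cdotZr -pr tE amE mulrCA.
(* This is [dot theta p = Q] divided by [a ^+ m H]. *)
- exists (g * p1); apply: (mulfI (am0 (m H))).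
  rewrite mulrBr -defpolyD1 // -thetap dotE gE p1E tE.
  ring.
Qed.

End Planar.

(** * Lifting forms on H whose only pole is along one X *)

Section LocalLift.
Variables (K : fieldType) (l k : nat).
Local Notation S := {mpoly K[l]}.
Local Notation Sbar := {mpoly K[k]}.
Local Notation space := {vspace 'rV[K]_l}.
Variables (A : {fset space}) (m : space -> nat).
Variable alpha : space -> 'Hom('rV[K]_l, K^o).
Hypotheses (A_arr : arrangement A) (alphaP : defining_forms A alpha).
Variable H : space.
Hypotheses (HA : H \in A) (mH : (0 < m H)%N).
Variables (iota : 'Hom('rV[K]_k, 'rV[K]_l)) (rho : 'Hom('rV[K]_l, 'rV[K]_k)).
Hypotheses (iota_img : limg iota = H) (iotaK : (rho \o iota)%VF = \1%VF).
Local Notation a := (lin_poly (alpha H)).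
Local Notation m' := (mult_pred m H).
Local Notation res := (poly_restr iota).
Local Notation lift := (poly_restr rho).
Local Notation Q0 := (defpoly (A `\ H) m alpha).
Local Notation num_restr := (num_restr m alpha H iota).

Let alpha0 := defining_form_neq0 A_arr alphaP.
Let alphaN := defining_form_ndvd A_arr alphaP.
Let kerH := alphaP HA.

(** A form without poles on H extends to V by pullback along [rho]. *)
Lemma num_restr_poly (s : 'rV[Sbar]_k) :
  exists2 p, poly_log A m' alpha p & num_restr p (res Q0 *: s).
Proof.
exists (defpoly A m' alpha *: pull_row rho s) => [L LA u _|i].
  by rewrite cdotZr; apply/divides_mulr/defpoly_divides.
exists (Q0 * lift (s 0 i)).
  rewrite cdotZr cdot_pull_row (rho_iota iotaK) cdot_delta.
  by rewrite (defpoly_pred _ _ HA) mulrA.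
by rewrite rmorphM /= (restr_liftK iotaK) mxE.
Qed.

Lemma res_defpoly_neq0 (B : {fset space}) : B `<=` A -> H \notin B ->
  res (defpoly B m alpha) != 0.
Proof.
move=> sBA HB; apply/eqP => /(res_eq0 alpha0 HA kerH iota_img iotaK).
apply: prime_ndvd_prod => [|L LB]; first exact/prime_lin_poly/alpha0.
apply: alphaN => //; first exact: (fsubsetP sBA).
by apply: contraNneq HB => ->.
Qed.

Variable pi : 'Hom('rV[K]_l, 'rV[K]_2).
Hypotheses (pi_full : limg pi = fullv) (ker_piH : (lker pi <= H)%VS).
Local Notation loc := (localization A (lker pi)).
Local Notation A2 := (essentialization loc pi).
Local Notation m2 := (fun L => m (pi @^-1: L)%VS).

Lemma localizationP L : (L \in loc) = (L \in A) && (lker pi <= L)%VS.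
Proof. by rewrite !inE. Qed.

Lemma mem_localization : H \in loc.
Proof. by rewrite localizationP HA. Qed.

Lemma preim_img L : (lker pi <= L)%VS -> (pi @^-1: (pi @: L))%VS = L.
Proof.
move=> kL; apply/vspaceP => u; rewrite -memv_preim; apply/idP/idP => [|uL].
  case/memv_imgP => x xL pux; rewrite -[u](subrK x) memvD //.
  by apply: (subvP kL); rewrite memv_ker linearB /= pux subrr.
exact: memv_img.
Qed.

Lemma loc_img_inj : {in loc &, injective (fun L => pi @: L)%VS}.
Proof.
move=> L M; rewrite !localizationP => /andP[_ kL] /andP[_ kM] e.
by rewrite -(preim_img kL) e preim_img.
Qed.

Lemma essential_arrangement : arrangement A2.
Proof.
move=> M /imfsetP[L /=]; rewrite localizationP => /andP[LA kL] ->.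
have := limg_ker_dim pi L; rewrite (capv_idPr kL).
have := limg_ker_dim pi fullv; rewrite capfv pi_full !dimvf /dim /= !mul1n.
move=> e2 e1; apply/eqP.
by rewrite -(eqn_add2l (\dim (lker pi))) addnS e1 e2 (A_arr LA).
Qed.

Variable gamma : {vspace 'rV[K]_2} -> 'Hom('rV[K]_2, K^o).
Hypothesis gammaP : defining_forms A2 gamma.

Lemma loc_ess L : L \in loc -> (pi @: L)%VS \in A2.
Proof. by move=> Lloc; apply/imfsetP; exists L. Qed.

(** Both forms have kernel L, hence are proportional; [gamma] being an arbitrary choice, such
    scalars are carried through the section. *)
Lemma gamma_pi L : L \in loc ->
  exists2 c : K, c != 0 & forall u, gamma (pi @: L)%VS (pi u) = c * alpha L u.
Proof.
move=> Lloc; have := Lloc; rewrite localizationP => /andP[LA kL].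
have [|c c0 cE] := @lform_proportional _ _ (gamma (pi @: L)%VS \o pi)%VF _ (alpha0 LA).
  rewrite alphaP //; apply/vspaceP => u.
  rewrite memv_ker comp_lfunE -memv_ker gammaP ?loc_ess //.
  by rewrite memv_preim preim_img.
by exists c => // u; rewrite -cE comp_lfunE.
Qed.

Lemma poly_restr_gamma L : L \in loc -> exists2 c : K, c != 0 &
  poly_restr pi (lin_poly (gamma (pi @: L)%VS)) = c *: lin_poly (alpha L).
Proof.
move=> /gamma_pi[c c0 cE]; exists c => //.
by rewrite poly_restr_lin -lin_polyZ; apply: lin_polyE => i; apply: cE.
Qed.

Lemma poly_restr_defpoly : exists2 c : K, c != 0 &
  poly_restr pi (defpoly A2 m2 gamma) = c *: defpoly loc m alpha.
Proof.
rewrite /defpoly big_imfset /=; last exact: loc_img_inj.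
have locE L : L \in enum_fset loc -> exists2 c : K, c != 0 &
  poly_restr pi (lin_poly (gamma (pi @: L)%VS) ^+ m (pi @^-1: (pi @: L))%VS)
    = c *: lin_poly (alpha L) ^+ m L.
  move=> Lloc; have [c c0 cE] := poly_restr_gamma (Lloc : L \in loc).
  have := Lloc : L \in loc; rewrite localizationP => /andP[LA kL].
  exists (c ^+ m L); first exact: expf_neq0.
  by rewrite preim_img // rmorphXn /= cE -!mul_mpolyC exprMn rmorphXn.
elim: (enum_fset loc) locE => [_|L s IHs Hs].
  by rewrite !big_nil; exists 1; rewrite ?oner_neq0 // rmorph1 scale1r.
have [|c c0 cE] := IHs; first by move=> M Ms; apply: Hs; rewrite inE Ms orbT.
have [|d d0 dE] := Hs L; first by rewrite mem_head.
exists (d * c); first by rewrite mulf_neq0.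
by rewrite !big_cons rmorphM /= cE dE -scalerAl -scalerAr scalerA.
Qed.

Variables (theta phi : 'rV[{mpoly K[2]}]_2) (d : nat).
Hypothesis basis2 : is_basis (log_der A2 m2 gamma) [tuple theta; phi].
Hypothesis theta_homog : der_homog d theta.
Hypothesis dvd_phi : der_dvd (lin_poly (gamma (pi @: H)%VS)) phi.
Variable b : 'Hom('rV[K]_k, K^o).
Hypotheses (b0 : b != 0) (ker_b : forall w, b w = 0 <-> pi (iota w) = 0).

(** A nonzero multiple of [db / b^d] lifts. The planar form dual to [theta] is pulled back along
    [pi]; on H its coefficient [t] satisfies [Q0 = theta(y) t], and [theta(y)] becomes a multiple of
    [b^d]. *)
Lemma num_restr_pole : exists p s (c : K), [/\ poly_log A m' alpha p,
  num_restr p s, c != 0 & forall i,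
    lin_poly b ^+ d * s 0 i = (c * b (delta_mx 0 i)) *: res Q0].
Proof.
have A2_arr := essential_arrangement.
have gamma0 := defining_form_neq0 A2_arr gammaP.
have gammaN := defining_form_ndvd A2_arr gammaP.
pose H2 := (pi @: H)%VS; have H2A : H2 \in A2 by apply: loc_ess mem_localization.
have H2K : (pi @^-1: H2)%VS = H by apply: preim_img.
have m2H : (0 < m2 H2)%N by rewrite /= H2K.
have [v [w [y [gw uE]]]] := plane_coord (gamma0 _ H2A).
have [r [t [rL rw tE]]] := planar_form gamma0 gammaN H2A m2H basis2 dvd_phi gw uE.
have [c c0 cE] := gamma_pi mem_localization; rewrite -/H2 in cE.
have piE x : pi (iota x) = y (pi (iota x)) *: w.
  by rewrite {1}[pi _]uE cE (alpha_iota kerH iota_img) mulr0 scale0r add0r.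
pose Y : 'Hom('rV[K]_k, K^o) := (y \o (pi \o iota))%VF.
have YE x : Y x = y (pi (iota x)) by rewrite !comp_lfunE.
have [e e0 eE] : exists2 e : K, e != 0 & forall x, Y x = e * b x.
  apply: lform_proportional => //; apply/vspaceP => x; rewrite !memv_ker YE.
  apply/eqP/eqP => [yx|/ker_b ->]; last by rewrite linear0.
  by apply/ker_b; rewrite piE yx scale0r.
(* The hyperplanes not containing X: multiplying a numerator by [R] changes the denominator from
   that of the localization to that of [A]. *)
pose R := defpoly [fset L in A | ~~ (lker pi <= L)%VS] m alpha.
pose Qloc := defpoly (loc `\ H) m alpha.
have splitA : defpoly A m alpha = defpoly loc m alpha * R.
  by rewrite /defpoly (big_fsetID _ (fun L => (lker pi <= L)%VS)).
have am0 : a ^+ m H != 0 by rewrite expf_neq0 // lin_poly_neq0 ?alpha0.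
have Q0E : Q0 = Qloc * R.
  apply: (mulfI am0); rewrite -defpolyD1 // splitA mulrA.
  by rewrite (defpolyD1 _ _ mem_localization).
have [c2 c20 c2E] := poly_restr_defpoly.
set a2 := lin_poly (gamma H2) in rw tE.
have a2E : poly_restr pi a2 = c *: a.
  by rewrite poly_restr_lin -lin_polyZ; apply: lin_polyE => i; apply: cE.
have a2XE n : poly_restr pi (a2 ^+ n) = c ^+ n *: a ^+ n.
  by rewrite rmorphXn /= a2E -!mul_mpolyC exprMn rmorphXn.
have QlocE : c ^+ m H *: poly_restr pi (defpoly (A2 `\ H2) m2 gamma) = c2 *: Qloc.
  apply: (mulfI am0); rewrite -!scalerAr -(defpolyD1 _ _ mem_localization) -c2E.
  by rewrite (defpolyD1 m2 gamma H2A) rmorphM /= H2K a2XE -scalerAl.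
pose z := (der_app theta (lin_poly y)).@[w 0].
(* The planar congruence modulo [a2] becomes an equality on H. There [pi] takes values in the line
   spanned by [w], where [theta(y)], homogeneous of degree [d], is [z] times the d-th power of the
   coordinate. *)
have resE : res (poly_restr pi (defpoly (A2 `\ H2) m2 gamma))
    = (z * e ^+ d) *: (lin_poly b ^+ d * res (poly_restr pi t)).
  have [g /(congr1 (poly_restr pi))/(congr1 res)] := tE.
  rewrite !rmorphB !rmorphM /= a2E poly_restrZ.
  have -> : res a = 0 by apply/(res_eq0 alpha0 HA kerH iota_img iotaK)/divides_refl.
  rewrite scaler0 mulr0 => /eqP; rewrite subr_eq0 => /eqP->.
  rewrite poly_restr_comp (@poly_restr_homog _ _ _ _ Y w d) => [|x|].
  - have -> : lin_poly Y = e *: lin_poly b by rewrite -lin_polyZ; apply: lin_polyE => i.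
    by rewrite -/z -!mul_mpolyC exprMn rmorphM rmorphXn /= !mulrA.
  - by rewrite YE comp_lfunE.
  - rewrite der_app_lin rpred_sum // => j _; rewrite -mul_mpolyC mul_mpolyC.
    exact/dhomogZ/theta_homog.
have Qloc0 : res Qloc != 0.
  apply: res_defpoly_neq0; last by rewrite !inE eqxx.
  by apply/fsubsetP => L /fsetD1P[_]; rewrite localizationP => /andP[].
have main : (c ^+ m H * z * e ^+ d) *: (lin_poly b ^+ d * res (poly_restr pi t))
    = c2 *: res Qloc.
  by rewrite -!poly_restrZ -QlocE !poly_restrZ resE scalerA mulrA.
have z0 : c ^+ m H * z * e ^+ d != 0.
  apply: contraNneq Qloc0 => z0; move: main; rewrite z0 scale0r => /esym/eqP.
  by rewrite scaler_eq0 (negPf c20).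
(* [e] converts [Y] into [b], [c ^+ (m H).-1] comes from the pullback of [a2 ^+ (m H).-1], and the
   quotient is [main] solved for the product of [b^d] and the restriction of [t]. *)
pose C := e * c ^+ (m H).-1 * (c2 / (c ^+ m H * z * e ^+ d)).
pose T i := R * ((Y (delta_mx 0 i) * c ^+ (m H).-1) *: poly_restr pi t).
exists (R *: pull_row pi r), (\row_i res (T i)), C; split.
- move=> L LA u u0; rewrite cdotZr.
  have [kL|nkL] := boolP (lker pi <= L)%VS; last first.
    apply: divides_mulr; apply: (@divides_trans _ _ (lin_poly (alpha L) ^+ m L)).
      by exists (lin_poly (alpha L) ^+ (m L - m' L)); rewrite -exprD subnK // leq_subr.
    by apply: defpoly_divides; rewrite !inE LA.
  have Lloc : L \in loc by rewrite localizationP LA.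
  have [cL cL0 cLE] := gamma_pi Lloc.
  apply: divides_mull; rewrite cdot_pull_row.
  have [|f ->] := rL _ (loc_ess Lloc) (pi u); first by rewrite cLE u0 mulr0.
  rewrite rmorphM rmorphXn /=; apply: divides_mull.
  have -> : mult_pred m2 H2 (pi @: L)%VS = m' L.
    rewrite /mult_pred preim_img //; congr (_ - nat_of_bool _)%N.
    apply/eqP/eqP => [|->//]; exact: loc_img_inj mem_localization.
  have [cL' _ ->] := poly_restr_gamma Lloc.
  by rewrite -mul_mpolyC exprMn; apply/divides_mull/divides_refl.
- move=> i; exists (T i); last by rewrite mxE.
  rewrite cdotZr cdot_pull_row piE cdotZl rw poly_restrZ rmorphM /= H2K a2XE /T YE.
  by rewrite -!mul_mpolyC rmorphM /=; ring.
- by rewrite /C !mulf_neq0 ?expf_neq0 ?invr_neq0.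
- move=> i; rewrite mxE /T Q0E !rmorphM /= poly_restrZ eE.
  have {}main : lin_poly b ^+ d * res (poly_restr pi t)
      = (c2 / (c ^+ m H * z * e ^+ d)) *: res Qloc.
    by apply: (scalerI z0); rewrite main scalerA mulrCA divff // mulr1.
  transitivity ((e * b (delta_mx 0 i) * c ^+ (m H).-1)%:MP * res R
      * (lin_poly b ^+ d * res (poly_restr pi t))).
    by rewrite -mul_mpolyC; ring.
  by rewrite main /C -!mul_mpolyC !rmorphM /=; ring.
Qed.

(** With [b w = 1], [q] is [cdot w q] times [db] plus a row divisible by [b^d]. After division by
    [b^d] the first part lifts by [num_restr_pole] and the second by [num_restr_poly]. *)
Lemma num_restr_local (q : 'rV[Sbar]_k) :
    (forall u, b u = 0 -> divides (lin_poly b ^+ d) (cdot u q)) ->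
  exists p s, [/\ poly_log A m' alpha p, num_restr p s &
    lin_poly b ^+ d *: s = res Q0 *: q].
Proof.
move=> bq; have /lform_neq0P[w bw] := b0.
have /fin_all_exists[s0 s0E] j : divides (lin_poly b ^+ d)
    (cdot (delta_mx 0 j - b (delta_mx 0 j) *: w) q).
  by apply: bq; rewrite linearB linearZ /= bw -[_ *: 1]/(_ * 1) mulr1 subrr.
have [p1 [s1 [c [p1L p1s c0 s1E]]]] := num_restr_pole.
have [p0 p0L p0s] := num_restr_poly (\row_j s0 j).
pose h := c^-1 *: cdot w q.
exists (lift h *: p1 + p0), (h *: s1 + res Q0 *: \row_j s0 j); split.
- by apply: poly_logD => //; apply: poly_logZ.
- by apply: num_restrD => //; rewrite -{2}[h](restr_liftK iotaK); apply: num_restrZ.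
- apply/rowP => j; rewrite !mxE.
  have -> : q 0 j = b (delta_mx 0 j) *: cdot w q + s0 j * lin_poly b ^+ d.
    by rewrite -s0E cdotBl cdotZl cdot_delta addrC subrK.
  rewrite mulrDr [_ ^+ d * (h * _)]mulrCA s1E /h -!mul_mpolyC.
  have cc : c^-1%:MP * c%:MP = 1 :> Sbar by rewrite -rmorphM mulVf ?rmorph1.
  by rewrite rmorphM /=; ring: cc.
Qed.

End LocalLift.

(** * Dimensions in the restricted arrangement, and assembly of the local lifts *)

Lemma restrictionP (K : fieldType) l k (iota : 'Hom('rV[K]_k, 'rV[K]_l)) A H X :
  limg iota = H -> X \in restriction iota A H -> exists L, [/\ L \in A, L != H & (iota @: X)%VS = (L :&: H)%VS].
Proof.
move=> iH /imfsetP[L /= /fsetD1P[LH LA] ->]; exists L; split=> //.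
by rewrite lpreimK // iH capvSr.
Qed.

Lemma dim_img_inj (K : fieldType) l k (iota : 'Hom('rV[K]_k, 'rV[K]_l)) rho X :
  (rho \o iota)%VF = \1%VF -> \dim (iota @: X) = \dim X.
Proof.
move=> iotaK; rewrite limg_dim_eq //; apply/eqP; rewrite -subv0.
apply/subvP => u /memv_capP[_]; rewrite memv_ker memv0 => /eqP iu.
by rewrite -[u]id_lfunE -iotaK comp_lfunE iu linear0.
Qed.

(** Distinct hyperplanes span V, so their intersection has codimension 2, and the injective [iota]
    preserves dimensions. *)
Lemma restriction_arrangement (K : fieldType) l (A : {fset {vspace 'rV[K]_l}}) H
    (iota : 'Hom('rV[K]_l.-1, 'rV[K]_l)) rho :
    arrangement A -> H \in A -> (rho \o iota)%VF = \1%VF -> limg iota = H ->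
  arrangement (restriction iota A H).
Proof.
move=> A_arr HA iotaK iH X /(restrictionP iH)[L [LA LH iX]].
rewrite -(dim_img_inj X iotaK) iX.
have dH := A_arr _ HA; have dL := A_arr _ LA.
have : (\dim H < \dim (L + H))%N.
  rewrite ltn_neqAle dimvS ?addvSr // andbT.
  apply: contra LH => /eqP e.
  have /eqP eH : H == (L + H)%VS by rewrite eqEdim addvSr -e leqnn.
  by rewrite eqEdim -ltnS dH dL leqnn andbT eH addvSl.
have : (\dim (L + H) <= l)%N.
  by rewrite (leq_trans (dimvS (subvf _))) // dimvf /dim /= mul1n.
have := dimv_sum_cap L H; move: dH dL.
move: (\dim (L + H)) (\dim (L :&: H)) (\dim L) (\dim H) => /= a b c d; clear; lia.
Qed.

Theorem theorem1p3 (K : fieldType) (l : nat)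
  (A : {fset {vspace 'rV[K]_l}}) (m : {vspace 'rV[K]_l} -> nat)
  (alpha : {vspace 'rV[K]_l} -> 'Hom('rV[K]_l, K^o))
  (A_multi : multiarrangement A m)
  (alphaP : defining_forms A alpha)
  (A_free : free_multiarrangement A m alpha)
  (H : {vspace 'rV[K]_l}) (HA : H \in A)
  (iota : 'Hom('rV[K]_l.-1, 'rV[K]_l)) (rho : 'Hom('rV[K]_l, 'rV[K]_l.-1))
  (iota_img : limg iota = H)
  (iotaK : (rho \o iota)%VF = \1%VF)
  (beta : {vspace 'rV[K]_l.-1} -> 'Hom('rV[K]_l.-1, K^o))
  (betaP : defining_forms (restriction iota A H) beta)
  (mstar : {vspace 'rV[K]_l.-1} -> nat)
  (mstarP : forall X, X \in restriction iota A H ->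
     euler_multiplicity A m H (iota @: X)%VS (mstar X))
  (eta : 'rV[{fraction {mpoly K[l.-1]}}]_l.-1)
  (eta_log : log_form (restriction iota A H) mstar beta eta) :
  exists omega : 'rV[{fraction {mpoly K[l]}}]_l,
    log_form A (mult_pred m H) alpha omega /\
    form_restr iota (alpha H) rho omega eta.
Proof.
have [A_arr m_gt0] := A_multi; have mH := m_gt0 _ HA.
have alpha0 := defining_form_neq0 A_arr alphaP.
have alphaN := defining_form_ndvd A_arr alphaP.
set B := restriction iota A H in betaP mstarP eta_log.
have B_arr : arrangement B := restriction_arrangement A_arr HA iotaK iota_img.
have beta0 := defining_form_neq0 B_arr betaP.
have betaN := defining_form_ndvd B_arr betaP.
have [q etaE qL] := (log_formP mstar beta0 eta).1 eta_log.
have Q0 : poly_restr iota (defpoly (A `\ H) m alpha) != 0.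
  apply: (res_defpoly_neq0 _ A_arr alphaP HA iota_img iotaK).
    exact: fsubD1set.
  by rewrite !inE eqxx.
(* Cross-multiplication: [eta] is [q] over the defining polynomial of [B], and [p / Q(A, m')]
   restricts to [s] over the restriction of Q(A \ H, m). *)
suff [p [s [pL ps sE]]] : exists p s, [/\ poly_log A (mult_pred m H) alpha p,
    num_restr m alpha H iota p s &
    defpoly B mstar beta *: s = poly_restr iota (defpoly (A `\ H) m alpha) *: q].
  exists ((tofrac (defpoly A (mult_pred m H) alpha))^-1 *: map_mx (@tofrac _) p).
  split; first by apply/log_formP => //; exists p.
  apply: (form_restr_num alpha0 HA (alphaP _ HA) iota_img iotaK Q0 ps) => i.
  have QB0 := defpoly_neq0 mstar beta0.
  have /rowP/(_ i) := sE; rewrite !mxE => {}sE.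
  rewrite etaE !mxE mulrC; apply/eqP; rewrite eqr_div ?tofrac_eq0 //.
  by rewrite -!rmorphM tofrac_eq mulrC -sE mulrC.
(* The gluing starts from some X in [B]; if there is none, [eta] is polynomial and lifts
   directly. *)
have [B0|B0] := eqVneq B fset0.
  have [p pL ps] := num_restr_poly m alpha HA iotaK q.
  exists p, (poly_restr iota (defpoly (A `\ H) m alpha) *: q); split=> //.
  by rewrite B0 /defpoly big_seq_fset0 scale1r.
apply: (num_restr_glue alpha0 alphaN HA mH (alphaP _ HA) iota_img iotaK A_free beta0 betaN B0) => X XB.
(* The degree of [theta] is [mstar X], exactly the pole order allowed along X. *)
have [pi [gamma [theta [phi [e [[ker_pi pi_full] gammaP basis2 [th_d _] [_ dvd_phi]]]]]]] :=
  mstarP X XB.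
rewrite -ker_pi in gammaP basis2.
apply: (num_restr_local A_arr alphaP HA mH iota_img iotaK pi_full _ gammaP basis2 th_d dvd_phi) => //.
- by rewrite ker_pi -iota_img limgS ?subvf.
- exact: beta0.
(* [beta X] and [pi \o iota] both vanish exactly on X. *)
- move=> w; have bX : (beta X w == 0) = (w \in X) by rewrite -memv_ker betaP.
  have piX : (pi (iota w) == 0) = (w \in X).
    rewrite -memv_ker ker_pi; apply/idP/idP; last exact: memv_img.
    case/memv_imgP => x xX e1.
    by rewrite -[w](rho_iota iotaK) e1 (rho_iota iotaK).
  by split=> /eqP; rewrite ?bX ?piX => wX; apply/eqP; rewrite ?bX ?piX.
- exact: qL.
Qed.
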